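(* Let $N_{d-1}(2)=\binom{d}{2}+\binom{d-1}{1}$. (i) If there exists a proper locally two-distance set $X$ in $\mathbb{R}^d$ with more than $d(d+1)/2$ points, then there exists an $N_{d-1}(2)$-point two-distance set in $S^{d-2}$. (ii) If there exists a proper locally two-distance set $X$ in $S^{d-1}$ with more than $d(d+1)/2$ points, then there exists an $N_{d-1}(2)$-point two-distance set in $S^{d-2}$. In particular, a locally two-distance set in $S^{d-1}$ with more than $d(d+1)/2$ points is a subset of a tight spherical five-design.
   Context: $S^{n-1}$ is the unit sphere in $\mathbb{R}^n$. A set $X\subset\mathbb{R}^n$ is a two-distance set if there are exactly two distinct Euclidean distances between distinct points of $X$; it is a locally two-distance set if for every $x\in X$ there are at most two distinct distances between $x$ and the other points of $X$. A locally two-distance set is proper if it is not a two-distance set. A finite set $Z\subset S^{n-1}$ is a spherical $t$-design if $\frac{1}{|S^{n-1}|}\int_{S^{n-1}}f\,d\sigma=\frac{1}{|Z|}\sum_{z\in Z}f(z)$ for every polynomial $f$ in $n$ variables of degree at most $t$, where $\sigma$ is the surface measure and $|S^{n-1}|$ its total mass. A spherical five-design on $S^{n-1}$ has at least $2\binom{n+1}{2}=n(n+1)$ points and is called tight if it has exactly that many.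
   Formalization: The existence claims in (i) and (ii) are stated for d ≥ 3 (for d = 2, S^0 has no two-distance set; for d = 1 the conclusion also fails), and the last claim assumes the locally two-distance set is proper (the regular pentagon in S^1 is a counterexample otherwise). *)

(* Defs.v *)
From mathcomp Require Import all_boot all_order all_algebra.
From mathcomp Require Import finmap.
From mathcomp Require Import all_classical all_reals all_analysis.
From mathcomp Require Import -(notations) mpoly.

Set Implicit Arguments.
Unset Strict Implicit.
Unset Printing Implicit Defensive.

Import Order.TTheory GRing.Theory Num.Theory.
Import numFieldNormedType.Exports.

Local Open Scope classical_set_scope.
Local Open Scope card_scope.
Local Open Scope ring_scope.

(* The library norm [`|x|] on ['rV[R]_n] is the sup norm, so the Euclidean one
   is defined here. *)
Definition enorm (R : realType) (n : nat) (x : 'rV[R]_n) : R :=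
  Num.sqrt (\sum_(i < n) x 0 i ^+ 2).

Definition edist (R : realType) (n : nat) (x y : 'rV[R]_n) : R := enorm (x - y).

(* The unit sphere of R^n, i.e. S^(n-1). *)
Definition sphere (R : realType) (n : nat) : set 'rV[R]_n :=
  [set x | enorm x = 1].
Arguments sphere : clear implicits.

Definition distances (R : realType) (n : nat) (X : set 'rV[R]_n) : set R :=
  [set r | exists x y, [/\ X x, X y, x != y & r = edist x y]].

Definition distances_from (R : realType) (n : nat) (X : set 'rV[R]_n)
    (x : 'rV[R]_n) : set R :=
  [set r | exists y, [/\ X y, x != y & r = edist x y]].

Definition two_distance (R : realType) (n : nat) (X : set 'rV[R]_n) : Prop :=
  distances X #= `I_2.

Definition locally_two_distance (R : realType) (n : nat)
    (X : set 'rV[R]_n) : Prop :=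
  forall x, X x -> distances_from X x #<= `I_2.

Definition proper_locally_two_distance (R : realType) (n : nat)
    (X : set 'rV[R]_n) : Prop :=
  locally_two_distance X /\ ~ two_distance X.

(* Surface integral over the unit sphere of R^n, in spherical coordinates: on
   S^0 = {1, -1} it is the counting measure, and for n >= 2 a point is written
   (cos t, sin t * y) with t in [0, pi] and y in S^(n-2), where the surface
   measure is sin^(n-2) t dt dsigma(y). The value at n = 0 is irrelevant. *)
Fixpoint sphere_integral (R : realType) (n : nat) : ('rV[R]_n -> R) -> R :=
  match n with
  | 0 => fun=> 0
  | k.+1 =>
    match k return (('rV[R]_k -> R) -> R) -> ('rV[R]_k.+1 -> R) -> R with
    | 0 => fun _ f => f (const_mx 1) + f (const_mx (-1))
    | m.+1 => fun I f =>
        \int[lebesgue_measure]_(t in `[0, pi])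
          (sin t ^+ m *
           I (fun y => f (row_mx (cos t)%:M (sin t *: y) : 'rV[R]_(1 + m.+1))))
    end (@sphere_integral R k)
  end.

Definition poly_fun (R : realType) (n : nat) (p : mpoly n R)
    (x : 'rV[R]_n) : R :=
  meval (fun i => x 0 i) p.

(* [mpoly.msize p] is the total degree of [p] plus one (0 if p = 0). *)
Definition spherical_design (R : realType) (n t : nat)
    (Z : {fset 'rV[R]_n}) : Prop :=
  [set` Z] `<=` sphere R n /\
  forall p : mpoly n R, (mpoly.msize p <= t.+1)%N ->
    (sphere_integral (fun _ : 'rV[R]_n => 1))^-1
      * sphere_integral (poly_fun p) =
    (#|` Z|)%:R^-1 * \sum_(z <- Z) poly_fun p z.

Definition tight_spherical_five_design (R : realType) (n : nat)
    (Z : {fset 'rV[R]_n}) : Prop :=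
  spherical_design 5 Z /\ #|` Z| = (2 * 'C(n.+1, 2))%N.

(* Main.v *)
Require Import Defs.
From mathcomp Require Import all_boot all_order all_algebra.
From mathcomp Require Import finmap.
From mathcomp Require Import all_classical all_reals all_analysis.
From mathcomp Require Import -(notations) mpoly.
From mathcomp Require Import zify ring lra.

(** The proof rests on one dimension count.  If the points of [X] around [x] are
at distances [sqrt a_x] and [sqrt b_x], then the polynomial
[F_x(y) = (|x - y|^2 - a_x) (|x - y|^2 - b_x)] vanishes at every point of [X]
except [x].  When all of [X] lies on a sphere, [|x - y|^2] agrees with a
polynomial of degree one in [y], so [F_x] becomes quadratic; the [F_x] together
with the equation of the sphere are linearly independent, and a [k]-dimensional
flat carries at most [k (k + 3) / 2] points of this kind
([local_sphere_bound]).

Join any two points of [X] by an edge coloured by their distance.  Every vertex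
sees at most two colours and any two vertices see a common one, so that the
pairs of colours seen form either a star or a triangle ([star_or_triangle]); a
proper set of this size has at least three colours, because points at a single
mutual distance are affinely independent ([one_distance_bound]).
Either way [X] splits into groups with constant mutual distances.  The
directions of distinct groups are then orthogonal, so the dimensions [k_i] of
their flats add up to at most [d], and each group lies on a sphere as soon as
another one is non-empty.  Since [k (k + 3) / 2] is strictly superadditive, more
than [d (d + 1) / 2] points force one group [A] of exactly
[(d - 1) (d + 2) / 2] points together with two poles [p], [q], each
equidistant from [A] ([many_points_two_poles]).  The count alone leaves open one
configuration, a triangle with a single one-point group, that point being the
common centre of the two others; it is excluded by a sharper bound for
two-distance sets whose inner products have nonnegative sum ([relative_bound]).

For the first two statements, [A] lies in a hyperplane orthogonal to [p - q] and
on a sphere, and a rotation and a scaling bring it to the unit sphere of the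
space of one dimension less ([sphere_two_distance]).

If [X] lies on the unit sphere and [d > 1], then the differences of points of [A]
span a hyperplane orthogonal to both poles, whence [q = - p].  If the distances
from [A] to [p] and [q] agree, then [A] lies on the equator and its points are
orthogonal or at one other distance, which the dimension count excludes
([equator_false]).  Otherwise [p] and the points of [A] span [d (d + 1) / 2]
equiangular lines.  The squares of the
corresponding linear forms, corrected by a multiple of the squared norm, form a
basis of the quadratic forms; expanding a product of two linear forms in this
basis gives all second and fourth moments of the set [Z] of unit vectors on
these lines ([equiangular_moment2], [equiangular_moment4]).  They coincide with
the moments of the sphere, which polar coordinates reduce to integrals of
[sin^a cos^b], and which are those of a Gaussian vector up to a factor depending
on the degree only ([sphere_average]).  As [Z] is antipodal, its odd
moments vanish, and [Z] is a tight five-design containing [X].  On [S^0], the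
two-point sphere is itself the design. *)

Set Implicit Arguments.
Unset Strict Implicit.
Unset Printing Implicit Defensive.

Import Order.TTheory GRing.Theory Num.Theory.
Import numFieldNormedType.Exports.

Local Open Scope classical_set_scope.
Local Open Scope card_scope.
Local Open Scope ring_scope.

(** * Inner products *)

Definition dot (R : realType) (n : nat) (u v : 'rV[R]_n) : R :=
  (u *m v^T) 0 0.

Lemma dotE (R : realType) n (u v : 'rV[R]_n) :
  dot u v = \sum_i u 0 i * v 0 i.
Proof. by rewrite /dot mxE; apply: eq_bigr => i _; rewrite mxE. Qed.

Lemma dotC (R : realType) n (u v : 'rV[R]_n) : dot u v = dot v u.
Proof. by rewrite !dotE; apply: eq_bigr => i _; rewrite mulrC. Qed.

Lemma dotDl (R : realType) n (u v w : 'rV[R]_n) :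
  dot (u + v) w = dot u w + dot v w.
Proof. by rewrite /dot mulmxDl mxE. Qed.

Lemma dotZl (R : realType) n a (u w : 'rV[R]_n) :
  dot (a *: u) w = a * dot u w.
Proof. by rewrite /dot -scalemxAl mxE. Qed.

Lemma dotNl (R : realType) n (u w : 'rV[R]_n) : dot (- u) w = - dot u w.
Proof. by rewrite /dot mulNmx mxE. Qed.

Lemma dotDr (R : realType) n (u v w : 'rV[R]_n) :
  dot w (u + v) = dot w u + dot w v.
Proof. by rewrite dotC dotDl !(dotC w). Qed.

Lemma dotZr (R : realType) n a (u w : 'rV[R]_n) :
  dot w (a *: u) = a * dot w u.
Proof. by rewrite dotC dotZl (dotC w). Qed.

Lemma dotNr (R : realType) n (u w : 'rV[R]_n) : dot w (- u) = - dot w u.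
Proof. by rewrite dotC dotNl (dotC w). Qed.

Lemma dot0l (R : realType) n (u : 'rV[R]_n) : dot 0 u = 0.
Proof. by rewrite /dot mul0mx mxE. Qed.

Lemma dot0r (R : realType) n (u : 'rV[R]_n) : dot u 0 = 0.
Proof. by rewrite dotC dot0l. Qed.

Definition dot_linE := (dotDl, dotDr, dotNl, dotNr, dotZl, dotZr, dot0l, dot0r).

Lemma dot_suml (R : realType) n (S : finType) (f : S -> 'rV[R]_n) u :
  dot (\sum_s f s) u = \sum_s dot (f s) u.
Proof. by rewrite /dot mulmx_suml summxE. Qed.

Lemma dot_ge0 (R : realType) n (u : 'rV[R]_n) : 0 <= dot u u.
Proof. by rewrite dotE sumr_ge0 // => i _; rewrite -expr2 sqr_ge0. Qed.

Lemma dot_eq0 (R : realType) n (u : 'rV[R]_n) : (dot u u == 0) = (u == 0).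
Proof.
apply/idP/eqP => [|->]; last by rewrite dot0l.
rewrite dotE psumr_eq0 => [/allP h|i _]; last by rewrite -expr2 sqr_ge0.
apply/rowP => i; rewrite mxE.
by have := h i (mem_index_enum _); rewrite -expr2 sqrf_eq0 => /eqP.
Qed.

Lemma dot_gt0 (R : realType) n (u : 'rV[R]_n) : (0 < dot u u) = (u != 0).
Proof. by rewrite lt_def dot_ge0 andbT dot_eq0. Qed.

Lemma dot_delta (R : realType) n (u : 'rV[R]_n) i : dot u (delta_mx 0 i) = u 0 i.
Proof.
rewrite dotE (bigD1 i) //= mxE !eqxx mulr1 big1 ?addr0 // => j ji.
by rewrite mxE eqxx (negPf ji) mulr0.
Qed.

Lemma dot_tensor (R : realType) d (v x y : 'rV[R]_d) :
  dot (v *m (x^T *m y)) v = dot v x * dot v y.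
Proof.
rewrite mulmxA {1}/dot [v *m _]mx11_scalar mul_scalar_mx -scalemxAl mxE.
by rewrite -/(dot v x) (dotC v y).
Qed.

Definition sqdist (R : realType) n (u v : 'rV[R]_n) : R := dot (u - v) (u - v).

Lemma sqdistC (R : realType) n (u v : 'rV[R]_n) : sqdist u v = sqdist v u.
Proof. by rewrite /sqdist -opprB !dot_linE; ring. Qed.

Lemma sqdist_gt0 (R : realType) n (u v : 'rV[R]_n) :
  (0 < sqdist u v) = (u != v).
Proof. by rewrite dot_gt0 subr_eq0. Qed.

Lemma sqdistE (R : realType) n (u v : 'rV[R]_n) :
  sqdist u v = dot u u - 2 * dot u v + dot v v.
Proof. by rewrite /sqdist !dot_linE (dotC v u); ring. Qed.

Lemma sqdistBr (R : realType) n (u v p : 'rV[R]_n) :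
  sqdist (u - p) (v - p) = sqdist u v.
Proof. by rewrite /sqdist opprB addrA subrK. Qed.

Lemma enormE (R : realType) n (u : 'rV[R]_n) : enorm u = Num.sqrt (dot u u).
Proof. by rewrite /enorm dotE. Qed.

Lemma edistE (R : realType) n (u v : 'rV[R]_n) :
  Defs.edist u v = Num.sqrt (sqdist u v).
Proof. by rewrite /Defs.edist enormE. Qed.

Lemma sphereE (R : realType) n (u : 'rV[R]_n) : sphere R n u <-> dot u u = 1.
Proof.
rewrite /sphere /= enormE; split => [h|->]; last by rewrite sqrtr1.
by rewrite -[LHS]sqr_sqrtr ?dot_ge0// h expr1n.
Qed.

(** * Linear independence of quadratic polynomials *)

Lemma lin_dep (R : fieldType) (S I : finType) (phi : S -> I -> R) :
  (#|I| < #|S|)%N ->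
  exists c : S -> R, (exists s, c s != 0) /\ forall i, \sum_s c s * phi s i = 0.
Proof.
move=> hIS.
pose M := \matrix_(s < #|S|, i < #|I|) phi (enum_val s) (enum_val i).
have : kermx M != 0.
  rewrite -mxrank_eq0 mxrank_ker -lt0n subn_gt0.
  exact: leq_ltn_trans (rank_leq_col M) hIS.
case/rowV0Pn => v /sub_kermxP vM v0.
exists (fun s => v 0 (enum_rank s)); split.
  have [j hj] : exists j, v 0 j != 0.
    apply/existsP; rewrite -negb_forall; apply: contra v0 => /forallP h.
    by apply/eqP/rowP => j; rewrite mxE; apply/eqP.
  by exists (enum_val j); rewrite enum_valK.
move=> i; have := congr1 (fun A : 'rV_ _ => A 0 (enum_rank i)) vM.
rewrite !mxE => h; rewrite -[RHS]h (reindex_onto enum_val enum_rank) => [|s _].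
  apply: eq_big => [j|j _]; first by rewrite enum_valK eqxx.
  by rewrite !mxE enum_rankK enum_valK.
by rewrite enum_rankK.
Qed.

Lemma double_bin2 n : (2 * 'C(n.+1, 2) = n * n.+1)%N.
Proof. by elim: n => [//|n IHn]; rewrite binS bin1 mulnDr IHn; lia. Qed.

Lemma card_le_pairs k :
  #|{: {p : 'I_k * 'I_k | (p.1 <= p.2)%N}}| = 'C(k.+1, 2).
Proof.
rewrite card_sig -sum1_card.
rewrite -(pair_big_dep xpredT (fun i j : 'I_k => (i <= j)%N) (fun _ _ => 1%N)) /=.
rewrite (exchange_big_dep xpredT) //=.
transitivity (\sum_(j < k) j.+1)%N.
  apply: eq_bigr => j _; transitivity (\sum_(i < k | (i < j.+1)%N) 1)%N => //.
  by rewrite (big_ord_narrow (F := fun=> 1%N) (ltn_ord j)) sum1_card card_ord.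
by rewrite -(big_mkord xpredT succn) -bin2_sum big_nat_recl //= add0n.
Qed.

Lemma dot_mulmxr (R : realType) k (u : 'rV[R]_k) (B : 'M[R]_k) :
  dot (u *m B^T) u = dot (u *m B) u.
Proof. by rewrite [RHS]dotC /dot trmx_mul mulmxA. Qed.

(** A quadratic form only depends on the sums [B i j + B j i] with [i <= j], of
    which there are as many as pairs. *)
Lemma quad_dep (R : realType) (k : nat) (S : finType) (B : S -> 'M[R]_k) :
  ('C(k.+1, 2) < #|S|)%N ->
  exists c : S -> R, (exists s, c s != 0) /\
    forall u, \sum_s c s * dot (u *m B s) u = 0.
Proof.
rewrite -card_le_pairs => hS.
pose phi s (p : {p : 'I_k * 'I_k | (p.1 <= p.2)%N}) :=
  B s (val p).1 (val p).2 + B s (val p).2 (val p).1.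
have [c [c0 hc]] := lin_dep phi hS; exists c; split => // u.
pose M := \sum_s c s *: B s.
have M0 : M + M^T = 0.
  apply/matrixP => i j.
  have hM (i' j' : 'I_k) : (i' <= j')%N -> M i' j' + M j' i' = 0.
    move=> ij; have := hc (exist _ (i', j') ij); rewrite /phi /= => <-.
    rewrite !summxE -big_split /=; apply: eq_bigr => s _.
    by rewrite !mxE mulrDr.
  rewrite !mxE; have [/hM//|/ltnW/hM] := leqP i j.
  by rewrite addrC.
have -> : \sum_s c s * dot (u *m B s) u = dot (u *m M) u.
  rewrite mulmx_sumr dot_suml; apply: eq_bigr => s _.
  by rewrite -scalemxAr dotZl.
have : dot (u *m (M + M^T)) u = 0 by rewrite M0 mulmx0 dot0l.
by rewrite mulmxDr dotDl dot_mulmxr; lra.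
Qed.

(** Polynomials of degree at most two on the row space of [V] are homogenised by
    the extra variable [w]: they are quadratic forms in [\rank V + 1] variables. *)
Lemma quad_poly_dep (R : realType) (m d : nat) (V : 'M[R]_(m, d)) (S : finType)
    (B : S -> 'M[R]_d) (l : S -> 'rV[R]_d) (e : S -> R) :
  ('C((\rank V).+2, 2) < #|S|)%N ->
  exists c : S -> R, (exists s, c s != 0) /\
    forall w v, (v <= V)%MS ->
      \sum_s c s * (dot (v *m B s) v + w * dot (l s) v + w ^+ 2 * e s) = 0.
Proof.
move=> hS; pose U := row_base V.
pose Q s : 'M[R]_(1 + \rank V) :=
  block_mx (e s)%:M (l s *m U^T) 0 (U *m B s *m U^T).
have [c [c0 hc]] := quad_dep Q hS; exists c; split => // w v.
rewrite -(eq_row_base V) => /submxP [u vE].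
rewrite -[RHS](hc (row_mx w%:M u)); apply: eq_bigr => s _; congr (_ * _).
have -> : dot (v *m B s) v = (u *m (U *m B s *m U^T) *m u^T) 0 0.
  by rewrite vE /dot trmx_mul !mulmxA.
have -> : dot (l s) v = (l s *m U^T *m u^T) 0 0.
  by rewrite vE /dot trmx_mul !mulmxA.
rewrite /Q mul_row_block /dot tr_row_mx mul_row_col mulmx0 addr0 mulmxDl.
rewrite -!scalar_mxM tr_scalar_mx -scalar_mxM -[in w%:M *m _ *m _]mulmxA.
rewrite mul_scalar_mx; set X := (_ *m u^T); set Y := (_ *m u^T).
by rewrite !mxE !eqxx !mulr1n; ring.
Qed.

(** A polynomial of degree at most two in [v], homogenised by [w].  Keeping [w]
    free allows a relation to be tested at infinity, where [w = 0]. *)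
Definition quad_poly (R : realType) (d : nat) (q : R -> 'rV[R]_d -> R) : Prop :=
  exists B l e, forall w v,
    q w v = dot (v *m B) v + w * dot l v + w ^+ 2 * e.

Lemma quad_poly_mul (R : realType) d k1 k2 (z1 z2 : 'rV[R]_d) :
  quad_poly (fun w v => (w * k1 + dot z1 v) * (w * k2 + dot z2 v)).
Proof.
exists (z1^T *m z2), (k1 *: z2 + k2 *: z1), (k1 * k2) => w v.
by rewrite dot_tensor !dot_linE !(dotC v); ring.
Qed.

Lemma quad_poly_norm (R : realType) d (l : 'rV[R]_d) e :
  quad_poly (fun w v => dot v v + w * dot l v + w ^+ 2 * e).
Proof. by exists 1%:M, l, e => w v; rewrite mulmx1. Qed.

Lemma quad_poly_card (R : realType) (m d : nat) (V : 'M[R]_(m, d)) (S : finType)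
    (q : S -> R -> 'rV[R]_d -> R) :
  (forall s, quad_poly (q s)) ->
  (forall c : S -> R,
    (forall w v, (v <= V)%MS -> \sum_s c s * q s w v = 0) ->
    forall s, c s = 0) ->
  (#|S| <= 'C((\rank V).+2, 2))%N.
Proof.
move=> hq hc; rewrite leqNgt; apply/negP => hS.
have [B hB] := choice hq; have [l hl] := choice hB; have [e he] := choice hl.
have [c [[s cs] h]] := quad_poly_dep B l e hS.
move: cs; rewrite (hc c) ?eqxx // => w v vV; rewrite -[RHS](h w v vV).
by apply: eq_bigr => t _; rewrite he.
Qed.

(** * Two-distance bounds on spheres *)

(** The polynomials [F_s] and the equation of the sphere are independent:
    evaluating a relation at the points kills the coefficients of the [F_s],
    and the equation of the sphere does not vanish at infinity. *)
Lemma local_sphere_bound (R : realType) (m d : nat) (V : 'M[R]_(m, d)) (S : finType)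
    (z : S -> 'rV[R]_d) (rho : R) (a b : S -> R) (s0 s1 : S) :
  z s0 != z s1 ->
  (forall s t, (z s - z t <= V)%MS) ->
  (forall s, dot (z s) (z s) = rho) ->
  (forall s, a s != 0) -> (forall s, b s != 0) ->
  (forall s t, s != t -> sqdist (z s) (z t) = a s \/ sqdist (z s) (z t) = b s) ->
  (#|S|.+1 <= 'C((\rank V).+2, 2))%N.
Proof.
move=> z01 zV zrho a0 b0 hD.
pose k s := 2 * rho - 2 * dot (z s) (z s0).
pose q (o : S + 'I_1) w v :=
  match o with
  | inl s => (w * (k s - a s) + dot (- 2 *: z s) v) *
             (w * (k s - b s) + dot (- 2 *: z s) v)
  | inr _ => dot v v + w * dot (2 *: z s0) v + w ^+ 2 * 0
  end.
have <- : #|{: S + 'I_1}| = #|S|.+1 by rewrite card_sum card_ord addn1.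
apply: (quad_poly_card (q := q)) => [[s|i]|c hc].
- exact: quad_poly_mul.
- exact: quad_poly_norm.
have {}hc w v : (v <= V)%MS -> \sum_s c (inl s) * q (inl s) w v +
    c (inr ord0) * q (inr ord0) w v = 0.
  by move=> /hc => /(_ w); rewrite big_sumType big_ord1.
have qE s t : q (inl s) 1 (z t - z s0) =
    (sqdist (z s) (z t) - a s) * (sqdist (z s) (z t) - b s).
  by rewrite /q /k sqdistE !zrho !dot_linE; ring.
have gE t : q (inr ord0) 1 (z t - z s0) = 0.
  by rewrite /q !dot_linE !zrho (dotC (z s0)); ring.
have cs0 t : c (inl t) = 0.
  have := hc 1 _ (zV t s0); rewrite (bigD1 t) // big1 => [|s st].
    rewrite qE gE sqdistE !zrho /= => h; apply/eqP.
    have /eqP : c (inl t) * (a t * b t) = 0 by rewrite -[RHS]h; ring.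
    by rewrite !mulf_eq0 (negPf (a0 t)) (negPf (b0 t)) !orbF.
  rewrite qE.
  by have [->|->] := hD _ _ st; rewrite subrr ?mulr0 ?mul0r ?mulr0.
case=> [//|i]; rewrite ord1.
have := hc 0 _ (zV s0 s1).
rewrite big1 => [|s _]; last by rewrite cs0 mul0r.
rewrite /q mul0r expr0n /= mul0r !addr0 add0r => /eqP.
by rewrite mulf_eq0 dot_eq0 subr_eq0 (negPf z01) orbF => /eqP.
Qed.

(** Here the centre of the sphere is the origin of the space [V].  In terms of
    inner products, [a + b <= 4 rho] says that the two values have a nonnegative
    sum; then the products of [w] with linear forms can be added to the [F_s]
    without losing independence, because the odd part of a relation expresses
    the squared norm of its linear form as a nonpositive quantity. *)
Lemma relative_bound (R : realType) (m d : nat) (V : 'M[R]_(m, d)) (S : finType)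
    (z : S -> 'rV[R]_d) (rho a b : R) :
  0 < rho -> 0 < a -> 0 < b -> a + b <= 4 * rho ->
  (forall s, (z s <= V)%MS) ->
  (forall s, dot (z s) (z s) = rho) ->
  (forall s t, s != t -> sqdist (z s) (z t) = a \/ sqdist (z s) (z t) = b) ->
  (#|S| + (\rank V).+1 <= 'C((\rank V).+2, 2))%N.
Proof.
move=> rho0 a0 b0 hab zV zrho hD.
pose U := row_base V.
pose q (o : S + ('I_(\rank V) + 'I_1)) w v :=
  match o with
  | inl s => (w * (2 * rho - a) + dot (- 2 *: z s) v) *
             (w * (2 * rho - b) + dot (- 2 *: z s) v)
  | inr (inl i) => (w * 1 + dot 0 v) * (w * 0 + dot (row i U) v)
  | inr (inr _) => dot v v + w * dot 0 v + w ^+ 2 * - rho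
  end.
have <- : #|{: S + ('I_(\rank V) + 'I_1)}| = (#|S| + (\rank V).+1)%N.
  by rewrite !card_sum !card_ord addn1.
apply: (quad_poly_card (q := q)) => [[s|[i|i]]|c hc].
- exact: quad_poly_mul.
- exact: quad_poly_mul.
- exact: quad_poly_norm.
pose y := \sum_i c (inr (inl i)) *: row i U.
have yV : (y <= V)%MS.
  rewrite summx_sub // => i _; rewrite scalemx_sub //.
  by rewrite (submx_trans (row_sub _ _)) // eq_row_base.
pose g := c (inr (inr ord0)).
have {}hc w v : (v <= V)%MS ->
    \sum_s c (inl s) * q (inl s) w v + w * dot y v + g * (dot v v - rho * w ^+ 2) = 0.
  move=> /hc => /(_ w); rewrite !big_sumType big_ord1 /= => h; rewrite -[RHS]h.
  rewrite -!addrA; congr (_ + (_ + _)); last first.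
    by rewrite /q dot0l -/g; ring.
  rewrite dot_suml mulr_sumr; apply: eq_bigr => i _.
  by rewrite /q !dot_linE; ring.
have qE s t : q (inl s) 1 (z t) =
    (sqdist (z s) (z t) - a) * (sqdist (z s) (z t) - b).
  by rewrite /q sqdistE !zrho !dot_linE; ring.
have cE t : c (inl t) * (a * b) = - dot y (z t).
  have := hc 1 _ (zV t); rewrite (bigD1 t) // big1 => [|s st].
    rewrite qE sqdistE !zrho /= => h.
    apply/eqP; rewrite -subr_eq0; apply/eqP; rewrite -[RHS]h; ring.
  rewrite qE.
  by have [->|->] := hD _ _ st; rewrite subrr ?mulr0 ?mul0r ?mulr0.
have odd_part v : (v <= V)%MS ->
    2 * (4 * rho - a - b) * \sum_s c (inl s) * dot (z s) v = dot y v.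
  move=> vV; have h1 := hc 1 _ vV; have h2 := hc (-1) _ vV.
  have : \sum_s c (inl s) * q (inl s) 1 v - \sum_s c (inl s) * q (inl s) (-1) v
     = - 2 * dot y v.
    move: h1 h2; set A := \sum__ _; set B := \sum__ _ => h1 h2.
    by move: h1 h2; rewrite sqrrN expr1n; lra.
  rewrite -sumrB (eq_bigr (fun s => - 4 * (4 * rho - a - b) *
      (c (inl s) * dot (z s) v))) => [|s _].
    by rewrite -mulr_sumr; lra.
  by rewrite /q !dot_linE; ring.
(* [y] is the linear form of the relation; each [c (inl s)] is a negative multiple
   of [dot y (z s)] *)
have y0 : y = 0.
  apply/eqP; rewrite -dot_eq0 eq_le dot_ge0 andbT -(odd_part y yV).
  rewrite mulr_ge0_le0 //; first by lra.
  have ab0 : 0 < a * b by rewrite mulr_gt0.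
  apply: sumr_le0 => s _; rewrite -(ler_pM2l ab0) mulr0 mulrA.
  by rewrite [a * b * _]mulrC cE dotC mulNr oppr_le0 -expr2 sqr_ge0.
have cs0 t : c (inl t) = 0.
  apply/eqP; have := cE t; rewrite y0 dot0l oppr0 => /eqP.
  by rewrite mulf_eq0 mulf_eq0 (gt_eqF a0) (gt_eqF b0) !orbF.
have g0 : g = 0.
  have := hc 1 0 (sub0mx _ _); rewrite big1 => [|s _]; last by rewrite cs0 mul0r.
  rewrite !dot0r expr1n mulr1 mulr0 !add0r => /eqP.
  by rewrite mulf_eq0 oppr_eq0 (gt_eqF rho0) orbF => /eqP.
case=> [//|[i|i]]; last by rewrite ord1.
have : (\row_i c (inr (inl i))) *m U = 0 by rewrite mulmx_sum_row -[RHS]y0;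
  apply: eq_bigr => j _; rewrite mxE.
rewrite -(mul0mx _ U) => /(row_free_inj (row_base_free V)) /rowP /(_ i).
by rewrite !mxE.
Qed.

(** For an affine relation [c] between the points, the sum of
    [c s * |x s - x t|^2] does not depend on [t], while it equals [- c t * a]:
    the coefficients of [c] are equal, and their sum is zero. *)
Lemma one_distance_bound (R : realType) (d : nat) (S : finType)
    (x : S -> 'rV[R]_d) (a : R) :
  a != 0 -> (forall s t, s != t -> sqdist (x s) (x t) = a) -> (#|S| <= d.+1)%N.
Proof.
move=> a0 hD; rewrite leqNgt; apply/negP => hS.
pose phi s (o : 'I_1 + 'I_d) := match o with inl _ => 1 | inr i => x s 0 i end.
have [|c [[s0 cs0] hc]] := lin_dep phi (I := ('I_1 + 'I_d)%type) (S := S).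
  by rewrite card_sum !card_ord add1n.
have c_sum : \sum_s c s = 0.
  by rewrite -[RHS](hc (inl ord0)); apply: eq_bigr => s _; rewrite mulr1.
have cx : \sum_s c s *: x s = 0.
  apply/rowP => i; rewrite summxE mxE -[RHS](hc (inr i)).
  by apply: eq_bigr => s _; rewrite mxE.
pose K := \sum_s c s * dot (x s) (x s).
have cE t : c t = - K / a.
  apply: (mulIf a0); rewrite divfK //.
  have : \sum_s c s * sqdist (x s) (x t) = K.
    rewrite (eq_bigr (fun s => c s * dot (x s) (x s) - 2 * (dot (c s *: x s) (x t))
      + c s * dot (x t) (x t))) => [|s _].
      rewrite big_split sumrB /= -mulr_suml -mulr_sumr -dot_suml c_sum cx.
      by rewrite dot0l mul0r mulr0 subr0 addr0.
    by rewrite sqdistE dotZl; ring.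
  rewrite (bigD1 t) //= (eq_bigr (fun s => c s * a)) => [|s st]; last by rewrite hD.
  rewrite -mulr_suml; have := c_sum; rewrite (bigD1 t) //= => h.
  have -> : \sum_(s | s != t) c s = - c t by lra.
  by rewrite /sqdist subrr dot0l mulr0 add0r mulNr => <-; rewrite opprK.
have : #|S|%:R * (- K / a) = 0.
  by rewrite -[RHS]c_sum (eq_bigr _ (fun t _ => cE t)) sumr_const mulr_natl.
move=> /eqP; rewrite -(cE s0) mulf_eq0 (negPf cs0) orbF pnatr_eq0.
by rewrite -leqn0 leqNgt (leq_trans _ hS).
Qed.

Lemma dot_sum_delta (R : realType) n (u : 'rV[R]_n) :
  \sum_i dot u (delta_mx 0 i) ^+ 2 = dot u u.
Proof. by rewrite dotE; apply: eq_bigr => i _; rewrite dot_delta expr2. Qed.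

(** Squared distance 2 means orthogonality, and makes [F_s] a product of a linear
    form with an affine one.  Then the constant [w^2] can be added to the family:
    a relation would make the squares of the linear forms sum to a multiple of
    the squared norm, and taking traces would force [#|S| = n (b / 2)]. *)
Lemma orthogonal_bound (R : realType) (n : nat) (S : finType)
    (z : S -> 'rV[R]_n) (b : R) :
  b != 0 -> #|S|%:R != n%:R * (b / 2) ->
  (forall s, dot (z s) (z s) = 1) ->
  (forall s t, s != t -> sqdist (z s) (z t) = 2 \/ sqdist (z s) (z t) = b) ->
  (#|S|.+2 <= 'C(n.+2, 2))%N.
Proof.
move=> b0 hN z1 hD.
pose q (o : S + ('I_1 + 'I_1)) w v :=
  match o with
  | inl s => (w * 0 + dot (z s) v) * (w * (b / 2 - 1) + dot (z s) v)
  | inr (inl _) => (w * 1 + dot 0 v) * (w * 1 + dot 0 v)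
  | inr (inr _) => dot v v + w * dot 0 v + w ^+ 2 * - 1
  end.
have <- : #|{: S + ('I_1 + 'I_1)}| = #|S|.+2 by rewrite !card_sum !card_ord addn2.
rewrite -[n in 'C(n.+2, _)](mxrank1 R).
apply: (quad_poly_card (q := q)) => [[s|[i|i]]|c hc].
- exact: quad_poly_mul.
- exact: quad_poly_mul.
- exact: quad_poly_norm.
pose e := c (inr (inl ord0)); pose g := c (inr (inr ord0)).
have {}hc w v : \sum_s c (inl s) * q (inl s) w v + e * w ^+ 2
    + g * (dot v v - w ^+ 2) = 0.
  have /= := hc w v (submx1 _); rewrite !big_sumType !big_ord1 /= => h.
  by rewrite -[RHS]h /= dot0l -/e -/g; ring.
have eg : e = g.
  have := hc 1 0; rewrite big1 => [|s _]; last by rewrite /q !dot0r; ring.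
  by rewrite dot0r expr1n; lra.
have cE t : c (inl t) = - e / (b / 2).
  have b20 : b / 2 != 0 by rewrite mulf_neq0 // invr_neq0 // pnatr_eq0.
  apply: (mulIf b20); rewrite divfK //.
  have := hc 1 (z t); rewrite (bigD1 t) // big1 => [|s st].
    by rewrite /q /= !z1 expr1n; lra.
  have := hD _ _ st; rewrite sqdistE !z1 /q => h.
  have [->|->] : dot (z s) (z t) = 0 \/ dot (z s) (z t) = 1 - b / 2.
  - by case: h => h; [left|right]; lra.
  - by rewrite /=; ring.
  - by rewrite /=; ring.
have e0 : e = 0.
  have hv v : - e / (b / 2) * \sum_s dot (z s) v ^+ 2 + e * dot v v = 0.
    rewrite -[RHS](hc 0 v) mulr_sumr -eg expr0n /=.
    congr (_ + _); last by rewrite mulr0n; ring.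
    rewrite [e * 0]mulr0 addr0; apply: eq_bigr => s _.
    by rewrite cE /q !mul0r !add0r expr2.
  have : \sum_i (- e / (b / 2) * (\sum_s dot (z s) (delta_mx 0 i) ^+ 2) +
      e * dot (delta_mx 0 i) (delta_mx 0 i)) = 0 :> R.
    by apply: big1 => i _; exact: hv.
  rewrite big_split /= -!mulr_sumr exchange_big /=.
  rewrite (eq_bigr (fun=> 1)) => [|s _]; last by rewrite dot_sum_delta z1.
  rewrite [X in _ + e * X](eq_bigr (fun=> 1)) => [|i _]; last first.
    by rewrite dot_delta mxE !eqxx.
  rewrite !sumr_const card_ord => h; apply/eqP; move: hN.
  apply: contraR => e0; apply/eqP/(mulIf e0).
  have {}h : (b / 2) * (- e / (b / 2) * #|S|%:R + e * n%:R) = 0.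
    by rewrite h mulr0.
  apply/eqP; rewrite -subr_eq0 -oppr_eq0; apply/eqP; rewrite -[RHS]h.
  by field.
case=> [t|[i|i]]; first by rewrite cE e0 oppr0 mul0r.
- by rewrite ord1.
- by rewrite ord1 -/g -eg.
Qed.

(** * Isometries of hyperplanes *)

(** The reflection exchanging [e] and the first basis vector. *)
Lemma householder (R : realType) (n : nat) (e : 'rV[R]_(1 + n)) :
  dot e e = 1 ->
  exists H : 'M[R]_(1 + n), H *m H^T = 1%:M /\ e *m H = row_mx 1%:M 0.
Proof.
move=> e1; pose e0 : 'rV[R]_(1 + n) := row_mx 1%:M 0.
have e01 : dot e0 e0 = 1.
  by rewrite /dot tr_row_mx mul_row_col trmx1 mulmx1 mul0mx addr0 mxE.
have [->|ne] := eqVneq e e0.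
  by exists 1%:M; rewrite trmx1 !mulmx1.
pose w := e - e0; have w0 : dot w w != 0 by rewrite dot_eq0 subr_eq0.
pose a := 2 / dot w w; pose H := 1%:M - a *: (w^T *m w).
have HT : H^T = H by rewrite /H linearB /= linearZ /= trmx1 trmx_mul trmxK.
have wH u : u *m H = u - (a * dot u w) *: w.
  rewrite mulmxBr mulmx1 -scalemxAr mulmxA [u *m w^T]mx11_scalar mul_scalar_mx.
  by rewrite scalerA.
exists H; split.
  apply/row_matrixP => i; rewrite HT !rowE mulmx1 mulmxA !wH.
  set u := delta_mx _ _; rewrite -addrA -opprD -scalerDl dotDl dotNl dotZl.
  have -> : a * dot u w + a * (dot u w - a * dot u w * dot w w) = 0.
    by rewrite /a; field.
  by rewrite scale0r subr0.
rewrite wH; have -> : a * dot e w = 1.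
  have wwE : dot w w = 2 * dot e w.
    by rewrite /w !dot_linE e1 e01 (dotC e0); ring.
  by rewrite /a wwE; field; move: w0; rewrite wwE mulf_eq0 pnatr_eq0.
by rewrite scale1r /w opprB addrC subrK.
Qed.

(** Once [e] is rotated to the first basis vector, all the points have the same
    first coordinate [tau], which can be dropped. *)
Lemma hyperplane_isometry (R : realType) (n : nat) (S : Type)
    (z : S -> 'rV[R]_n.+1) (e : 'rV[R]_n.+1) (tau : R) :
  dot e e = 1 -> (forall s, dot (z s) e = tau) ->
  exists y : S -> 'rV[R]_n,
    forall s t, dot (y s) (y t) = dot (z s) (z t) - tau ^+ 2.
Proof.
move=> e1 ztau; have [H [HH eH]] := @householder R n e e1.
pose zH s : 'rV[R]_(1 + n) := z s *m H.
have dotH u v : dot (u *m H) (v *m H) = dot u v.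
  by rewrite /dot trmx_mul mulmxA -(mulmxA u) HH mulmx1.
exists (fun s => rsubmx (zH s)) => s t.
have lE r : lsubmx (zH r) = tau%:M.
  rewrite [LHS]mx11_scalar; congr (_%:M).
  rewrite -(ztau r) -dotH eH /dot tr_row_mx -[z r *m H]/(zH r).
  by rewrite -{2}(hsubmxK (zH r)) mul_row_col trmx1 mulmx1 trmx0 mulmx0 addr0.
rewrite -dotH -/(zH s) -/(zH t).
rewrite -{2}(hsubmxK (zH s)) -{2}(hsubmxK (zH t)) /dot tr_row_mx mul_row_col.
rewrite !lE tr_scalar_mx -scalar_mxM; set X := (rsubmx _ *m _).
by rewrite [((_)%:M + _) _ _]mxE [(_%:M) _ _]mxE eqxx mulr1n; ring.
Qed.

(** * Equiangular lines *)

(** The forms [<e s, v>^2 - k |v|^2] vanish at all the unit vectors [e t] with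
    [t != s]; they are independent, and as numerous as the dimension of the
    space of quadratic forms, so the form with matrix [Q] is a combination of
    them, whose coefficients are read off at the points [e s]. *)
Lemma equiangular_expansion (R : realType) (d : nat) (S : finType)
    (e : S -> 'rV[R]_d) (k : R) (Q : 'M[R]_d) :
  k != 1 -> #|S| = 'C(d.+1, 2) ->
  (forall s, dot (e s) (e s) = 1) ->
  (forall s t, s != t -> dot (e s) (e t) ^+ 2 = k) ->
  forall v, (1 - k) * dot (v *m Q) v =
    \sum_s dot (e s *m Q) (e s) * (dot (e s) v ^+ 2 - k * dot v v).
Proof.
move=> k1 cS e1 ek v.
pose B (o : S + 'I_1) := match o with
  | inl s => (e s)^T *m e s - k%:M
  | inr _ => Q end.
have BE s u : dot (u *m B (inl s)) u = dot (e s) u ^+ 2 - k * dot u u.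
  rewrite /B mulmxBr mul_mx_scalar dotDl dotNl dotZl; congr (_ - _).
  by rewrite dot_tensor (dotC u) expr2.
have k1' : 1 - k != 0 by rewrite subr_eq0 eq_sym.
have [|c [[s0 cs0] hc]] := quad_dep B.
  by rewrite card_sum card_ord cS addn1.
have {}hc u : \sum_s c (inl s) * (dot (e s) u ^+ 2 - k * dot u u)
    + c (inr ord0) * dot (u *m Q) u = 0.
  have := hc u; rewrite big_sumType big_ord1 => h; rewrite -[RHS]h /=.
  by congr (_ + _); apply: eq_bigr => s _; rewrite -BE.
have cE t : c (inl t) * (1 - k) = - c (inr ord0) * dot (e t *m Q) (e t).
  have := hc (e t); rewrite (bigD1 t) //= big1 => [|s st].
    by rewrite !e1 expr1n; lra.
  by rewrite ek // e1 mulr1 subrr mulr0.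
have c0 : c (inr ord0) != 0.
  apply: contra cs0 => /eqP c0; case: s0 => [s|i]; last by rewrite ord1 c0.
  have /eqP := cE s; rewrite c0 oppr0 mul0r.
  by rewrite mulf_eq0 (negPf k1') orbF.
have h : (\sum_s c (inl s) * (dot (e s) v ^+ 2 - k * dot v v)) * (1 - k) =
    - c (inr ord0) * \sum_s dot (e s *m Q) (e s) * (dot (e s) v ^+ 2 - k * dot v v).
  rewrite mulr_suml mulr_sumr; apply: eq_bigr => s _.
  by rewrite mulrAC cE mulrA.
apply: (mulfI c0); apply: oppr_inj; rewrite -[RHS]mulNr -h.
by have /eqP := hc v; rewrite addr_eq0 => /eqP ->; ring.
Qed.

Lemma bin2_natr (R : realType) (n : nat) :
  2 * 'C(n.+1, 2)%:R = n%:R * (n%:R + 1) :> R.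
Proof. by rewrite natr1 -!natrM double_bin2. Qed.

Section EquiangularMoments.
Variables (R : realType) (d : nat) (S : finType) (e : S -> 'rV[R]_d) (k : R).
Hypotheses (k1 : k != 1) (cS : #|S| = 'C(d.+1, 2)).
Hypothesis e1 : forall s, dot (e s) (e s) = 1.
Hypothesis ek : forall s t, s != t -> dot (e s) (e t) ^+ 2 = k.

Let expansion Q := equiangular_expansion Q k1 cS e1 ek.

Lemma equiangular_sum_sqr v :
  \sum_s dot (e s) v ^+ 2 = (1 - k + #|S|%:R * k) * dot v v.
Proof.
have := expansion 1%:M v; rewrite mulmx1 => h.
rewrite mulrDl h -mulrA mulr_natl -sumr_const -big_split /=.
by apply: eq_bigr => s _; rewrite mulmx1 e1 mul1r subrK.
Qed.

(** Summing [equiangular_sum_sqr] over an orthonormal basis counts the lines. *)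
Lemma equiangular_angle : (1 < d)%N -> k = (d%:R + 2)^-1.
Proof.
move=> d1.
have h : \sum_i \sum_s dot (e s) (delta_mx 0 i) ^+ 2 =
   d%:R * (1 - k + #|S|%:R * k).
  rewrite (eq_bigr (fun=> 1 - k + #|S|%:R * k)) => [|i _].
    by rewrite sumr_const card_ord [RHS]mulr_natl.
  by rewrite equiangular_sum_sqr dot_delta mxE !eqxx mulr1.
move: h; rewrite exchange_big (eq_bigr (fun=> 1)) /= => [|s _]; last first.
  by rewrite dot_sum_delta.
rewrite sumr_const cS => h; have hN := bin2_natr R d.
have dge : (1 : R) < d%:R by rewrite ltr1n.
have d2 : d%:R + 2 != 0 :> R by rewrite gt_eqF //; lra.
apply: (mulIf d2); rewrite mulVf //.
have dm : d%:R * (d%:R - 1) != 0 :> R by rewrite gt_eqF // mulr_gt0 //; lra.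
apply: (mulfI dm); move: h hN; set N := 'C(_, _)%:R => h hN.
have -> : d%:R * (d%:R - 1) * 1 = 2 * (N - d%:R) by lra.
have -> : N - d%:R = d%:R * k * (N - 1) by lra.
have -> : 2 * (d%:R * k * (N - 1)) = d%:R * k * (2 * N - 2) by ring.
by rewrite hN; ring.
Qed.

Hypothesis kE : k = (d%:R + 2)^-1.

Let d2 : d%:R + 2 != 0 :> R.
Proof. by rewrite gt_eqF // ltr_wpDl. Qed.

Let NE : 1 - k + #|S|%:R * k = (d%:R + 1) / 2.
Proof.
rewrite cS kE; have := bin2_natr R d => hN.
have -> : 'C(d.+1, 2)%:R = d%:R * (d%:R + 1) / 2 :> R by rewrite -hN; field.
by field.
Qed.

Lemma equiangular_moment2 x y :
  \sum_s dot (e s) x * dot (e s) y = (d%:R + 1) / 2 * dot x y.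
Proof.
have hx := equiangular_sum_sqr x; have hy := equiangular_sum_sqr y.
have := equiangular_sum_sqr (x + y); rewrite NE in hx hy *.
rewrite !dot_linE (eq_bigr (fun s => dot (e s) x ^+ 2 + dot (e s) y ^+ 2 +
  2 * (dot (e s) x * dot (e s) y))) => [|s _]; last by rewrite dotDr; ring.
rewrite !big_split /= -mulr_sumr hx hy (dotC y); lra.
Qed.

(** The expansion of the product of the linear forms [x] and [y], polarised.  The
    value of [k] is what makes the result symmetric. *)
Lemma equiangular_moment4 x y u w :
  \sum_s dot (e s) x * dot (e s) y * (dot (e s) u * dot (e s) w) =
  (d%:R + 1) / (2 * (d%:R + 2)) *
  (dot x u * dot y w + dot x w * dot y u + dot x y * dot u w).
Proof.
have h v : \sum_s dot (e s) x * dot (e s) y * dot (e s) v ^+ 2 =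
    (1 - k) * (dot v x * dot v y) + k * ((d%:R + 1) / 2 * dot x y) * dot v v.
  rewrite -dot_tensor expansion -equiangular_moment2.
  rewrite -[X in _ + X]mulrA mulr_suml mulr_sumr -big_split /=; apply: eq_bigr => s _.
  by rewrite dot_tensor; ring.
have hu := h u; have hw := h w; have := h (u + w).
rewrite (eq_bigr (fun s => dot (e s) x * dot (e s) y * dot (e s) u ^+ 2 +
  dot (e s) x * dot (e s) y * dot (e s) w ^+ 2 +
  2 * (dot (e s) x * dot (e s) y * (dot (e s) u * dot (e s) w)))) => [|s _]; last first.
  by rewrite dotDr; ring.
rewrite !big_split /= -mulr_sumr hu hw !dot_linE (dotC w u) (dotC x u) (dotC x w).
rewrite (dotC y u) (dotC y w) => h2.
have two0 : 2 != 0 :> R by rewrite pnatr_eq0.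
apply: (mulfI two0); rewrite -[LHS](addKr (
  (1 - k) * (dot u x * dot u y) + k * ((d%:R + 1) / 2 * dot x y) * dot u u +
  ((1 - k) * (dot w x * dot w y) + k * ((d%:R + 1) / 2 * dot x y) * dot w w))).
by rewrite h2 kE; field; rewrite d2.
Qed.

End EquiangularMoments.

(** * Edge colourings in which every vertex sees at most two colours *)

Section Colouring.
Local Open Scope set_scope.
Variables (T : finType) (C : eqType) (D : T -> T -> C).

Definition sees (s : T) (c : C) : bool := [exists t, (t != s) && (D s t == c)].

Definition seers (a b : C) : {set T} := [set s | sees s a && sees s b].

Definition locally_two_coloured : Prop :=
  forall s t1 t2 t3, t1 != s -> t2 != s -> t3 != s ->
  [\/ D s t1 = D s t2, D s t1 = D s t3 | D s t2 = D s t3].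

Definition three_coloured : Prop :=
  exists a b c, [/\ a != b, b != c & a != c] /\
    [/\ exists s, sees s a, exists s, sees s b & exists s, sees s c].

Definition triangle (a b c : C) : Prop :=
  [/\ a != b, b != c & a != c] /\
  [/\ exists s, s \in seers a b, exists s, s \in seers b c
    & exists s, s \in seers a c].

Hypothesis DC : forall s t, D s t = D t s.
Hypothesis local : locally_two_coloured.

Lemma seesP s c : reflect (exists2 t, t != s & D s t = c) (sees s c).
Proof.
apply: (iffP existsP) => [[t /andP [ts /eqP]]|[t ts <-]]; exists t => //.
by rewrite ts eqxx.
Qed.

Lemma sees_D s t : t != s -> sees s (D s t).
Proof. by move=> ts; apply/seesP; exists t. Qed.

Lemma sees_DC s t : t != s -> sees s (D t s).
Proof. by rewrite DC; exact: sees_D. Qed.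

Lemma sees_two s a b c : a != b -> sees s a -> sees s b -> sees s c ->
  c = a \/ c = b.
Proof.
move=> ab /seesP [t1 n1 h1] /seesP [t2 n2 h2] /seesP [t3 n3 <-].
case: (local n1 n2 n3); rewrite ?h1 ?h2 => h; last by right.
  by move: ab; rewrite h eqxx.
by left.
Qed.

Lemma seersC a b : seers a b = seers b a.
Proof. by apply/setP => s; rewrite !inE andbC. Qed.

Lemma seers_D a b s t : a != b -> s \in seers a b -> t != s ->
  D s t = a \/ D s t = b.
Proof.
by rewrite inE => ab /andP [sa sb] ts; exact: sees_two ab sa sb (sees_D ts).
Qed.

Lemma seers_disjoint a b c s : b != c -> a != c -> a != b ->
  s \in seers a b -> s \in seers b c -> False.
Proof.
rewrite !inE => bc ac ab /andP [sa sb] /andP [_ sc].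
by case: (sees_two ab sa sb sc) => h; [move: ac|move: bc]; rewrite h eqxx.
Qed.

Lemma seers_cross a b c s t : b != c -> a != c -> a != b ->
  s \in seers a b -> t \in seers b c -> D s t = b.
Proof.
move=> bc ac ab sab tbc.
have st : s != t by apply/eqP => st; subst t; exact: seers_disjoint sab tbc.
have ts : t != s by rewrite eq_sym.
have [h|//] := seers_D ab sab ts.
have [|] := seers_D bc tbc st; rewrite DC h => h'.
  by move: ab; rewrite h' eqxx.
by move: ac; rewrite h' eqxx.
Qed.

Lemma triangle_rot a b c : triangle a b c -> triangle b c a.
Proof.
move=> [[ab bc ac] [h1 h2 h3]]; split; split => //; rewrite 1?eq_sym //.
  by rewrite seersC.
by rewrite seersC.
Qed.

Lemma triangle_cover a b c s : triangle a b c ->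
  [\/ s \in seers a b, s \in seers b c | s \in seers a c].
Proof.
move=> [[ab bc ac] [[u1 h1] [u2 h2] [u3 h3]]].
have [->|n1] := eqVneq s u1; first by constructor 1.
have [->|n2] := eqVneq s u2; first by constructor 2.
have [->|n3] := eqVneq s u3; first by constructor 3.
have d1 := seers_D ab h1 n1; have d2 := seers_D bc h2 n2.
have d3 := seers_D ac h3 n3.
have := sees_DC (s := s) (t := u1); rewrite eq_sym n1 => /(_ isT) e1.
have := sees_DC (s := s) (t := u2); rewrite eq_sym n2 => /(_ isT) e2.
have := sees_DC (s := s) (t := u3); rewrite eq_sym n3 => /(_ isT) e3.
case: d1 e1 => ->; case: d2 e2 => ->; case: d3 e3 => -> e3 e2 e1;
  by [ constructor 1; rewrite inE; apply/andP
     | constructor 2; rewrite inE; apply/andP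
     | constructor 3; rewrite inE; apply/andP ].
Qed.

(** Two vertices share the colour of the edge between them, so the colour pairs
    seen by the vertices form an intersecting family: either the three edges of
    a triangle, or all through one common colour [a].  In the second case the
    vertices seeing [g] form a group [A], every edge leaving [A] has colour [a],
    and the complement of [A] is either coloured with [a] and one other colour
    or splits in the same way. *)
Lemma star_or_triangle : three_coloured ->
  (exists a b c, triangle a b c) \/
  (exists (A : {set T}) a g b,
    [/\ (1 < #|A|)%N, (1 < #|~: A|)%N,
        forall s t, s \in A -> t \in ~: A -> D s t = a,
        forall s t, s \in A -> t \in A -> s != t -> D s t = a \/ D s t = g
      & forall s t, s \in ~: A -> t \in ~: A -> s != t -> D s t = a \/ D s t = b])
  \/ (exists (A B : {set T}) a,
    [/\ forall s, s \in A -> s \notin B, (1 < #|A|)%N, (1 < #|B|)%N & (1 < #|~: (A :|: B)|)%N] /\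
    [/\ forall s t, s \in A -> t \in B -> D s t = a,
        forall s t, s \in A -> t \in ~: (A :|: B) -> D s t = a
      & forall s t, s \in B -> t \in ~: (A :|: B) -> D s t = a]).
Proof.
move=> three.
have [tri|notri] := pselect (exists a b c, triangle a b c); first by left.
right.
have [s0 [a0 [b0 [g [[ab0 ag0 bg0] [h1 h2 [u hu]]]]]]] : exists s a b g,
    [/\ a != b, a != g & b != g] /\ [/\ sees s a, sees s b & exists u, sees u g].
  have [a [b [c [[ab bc ac] [[sa ha] [sb hb] [sc hc]]]]]] := three.
  have [two|one] := pselect (exists s x y, [/\ x != y, sees s x & sees s y]).
    have [s [x [y [xy hx hy]]]] := two.
    have [z [zx zy hz]] : exists z, [/\ x != z, y != z & exists u, sees u z].
      have [ax|ax] := eqVneq a x; last have [ay|ay] := eqVneq a y.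
      - have [yb|yb] := eqVneq y b.
          by exists c; rewrite -ax yb; split=> //; exists sc.
        by exists b; rewrite -ax; split => //; exists sb.
      - have [xb|xb] := eqVneq x b.
          by exists c; rewrite -ay xb; split=> //; exists sc.
        by exists b; rewrite -ay; split => //; exists sb.
      - by exists a; rewrite ![_ == a]eq_sym; split => //; exists sa.
    by exists s, x, y, z.
  exfalso; apply: one.
  have [sab|sab] := eqVneq sa sb; first by exists sa, a, b; rewrite {2}sab.
  have [dA|dA] := eqVneq (D sa sb) a.
    exists sb, a, b; split=> //; rewrite -dA; exact: sees_DC.
  by exists sa, (D sa sb), a; split => //; apply: sees_D; rewrite eq_sym.
(* [u] shares with [s0] one of the two colours: call it [a] *)
have [a [b [[ab ag bg] [sa sb ua]]]] : exists a b,
   [/\ a != b, a != g & b != g] /\ [/\ sees s0 a, sees s0 b & sees u a].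
  have us : u != s0.
    apply/eqP => us; subst u; have [h|h] := sees_two ab0 h1 h2 hu.
      by move: ag0; rewrite h eqxx.
    by move: bg0; rewrite h eqxx.
  have su : s0 != u by rewrite eq_sym.
  have := sees_DC su; have [->|->] := sees_two ab0 h1 h2 (sees_D us) => h.
    by exists a0, b0.
  by exists b0, a0; rewrite [b0 == a0]eq_sym.
have all_a t : sees t a.
  have [->//|ts] := eqVneq t s0; have [->//|tu] := eqVneq t u.
  have st : s0 != t by rewrite eq_sym.
  have ut : u != t by rewrite eq_sym.
  have := sees_DC st; have [->//|->] := sees_two ab sa sb (sees_D ts) => tb.
  have := sees_DC ut; have [->//|->] := sees_two ag ua hu (sees_D tu) => tg.
  exfalso; apply: notri; exists a, b, g; split; split => //.
  - by exists s0; rewrite inE sa.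
  - by exists t; rewrite inE tb.
  - by exists u; rewrite inE ua.
have card_class c : c != a -> (exists s, sees s c) ->
    (1 < #|[set t | sees t c]|)%N.
  move=> ca [s sc]; have /seesP [t ts e] := sc; apply/card_gt1P.
  exists s, t; split; rewrite ?inE // 1?eq_sym //.
  by rewrite -e; apply: sees_DC; rewrite eq_sym.
have cross c s t : c != a -> sees s c -> ~~ sees t c -> D s t = a.
  move=> ca sc tc; have ts : t != s by apply: contra tc => /eqP ->.
  have st : s != t by rewrite eq_sym.
  have [//|h] : D s t = a \/ D s t = c.
    by apply: sees_two (sees_D ts) => //; rewrite eq_sym.
  by move: tc; rewrite -h sees_DC.
have inner c s t : c != a -> sees s c -> s != t -> D s t = a \/ D s t = c.
  move=> ca sc st.
  by apply: sees_two (sees_D _) => //; rewrite eq_sym.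
have ga : g != a by rewrite eq_sym.
have ba : b != a by rewrite eq_sym.
pose A := [set t | sees t g]; pose B := [set t | sees t b].
have cA : (1 < #|A|)%N by apply: card_class => //; exists u.
have cB : (1 < #|B|)%N by apply: card_class => //; exists s0.
have disj t : t \in A -> t \notin B.
  rewrite !inE => tg; apply/negP => tb.
  have [h|h] := sees_two ag (all_a t) tg tb.
    by move: ab; rewrite h eqxx.
  by move: bg; rewrite h eqxx.
have [other|noother] := pselect (exists s t,
    [/\ s \notin A :|: B, t != s & D s t != a]).
  right; exists A, B, a; split; split => //.
  - have [s [t [sn ts h]]] := other.
    apply/card_gt1P; exists s, t; split; rewrite 1?eq_sym // finset.in_setC //.
    apply: contra h; rewrite finset.in_setU !inE.
    move: sn; rewrite finset.in_setU negb_or !inE => /andP [sA sB].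
    by case/orP => h; rewrite DC; [rewrite (cross g)|rewrite (cross b)].
  - move=> s t sA tB; apply: (cross g) => //; first by move: sA; rewrite inE.
    have : t \notin A by apply: contraL tB => /disj.
    by rewrite inE.
  - move=> s t; rewrite finset.in_setC finset.in_setU negb_or !inE => sA /andP [tA _].
    exact: (cross g).
  - move=> s t; rewrite finset.in_setC finset.in_setU negb_or !inE => sB /andP [_ tB].
    exact: (cross b).
left; exists A, a, g, b; split => //.
- apply: leq_trans cB _; apply/subset_leq_card/fintype.subsetP => t tB.
  by rewrite finset.in_setC; apply: contraL tB => /disj.
- by move=> s t; rewrite finset.in_setC !inE; exact: cross.
- by move=> s t; rewrite inE => sA _ st; exact: inner.
- move=> s t; rewrite !finset.in_setC => sA tA st.
  have [sB|sB] := boolP (s \in B).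
    by apply: inner => //; move: sB; rewrite inE.
  left; apply/eqP/negPn/negP => h; apply: noother; exists s, t.
  by rewrite finset.in_setU negb_or sA sB eq_sym.
Qed.

End Colouring.

(** * Locally two-distance sets with many points *)

Lemma orth_rank_add (R : realType) (m1 m2 d : nat) (V : 'M[R]_(m1, d))
    (W : 'M[R]_(m2, d)) :
  (forall v w, (v <= V)%MS -> (w <= W)%MS -> dot v w = 0) ->
  \rank (V + W)%MS = (\rank V + \rank W)%N.
Proof.
move=> h; apply: mxrank_disjoint_sum; apply/eqP/rowV0P => v.
by rewrite sub_capmx => /andP [vV vW]; apply/eqP; rewrite -dot_eq0 h.
Qed.

Section DistanceSets.
Local Open Scope set_scope.
Variables (R : realType) (d : nat) (T : finType) (x : T -> 'rV[R]_d).
Hypothesis x_inj : injective x.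

Let D s t := sqdist (x s) (x t).

Let DC s t : D s t = D t s. Proof. exact: sqdistC. Qed.

Let D_gt0 s t : s != t -> 0 < D s t.
Proof. by rewrite /D sqdist_gt0 (inj_eq x_inj). Qed.

(** The direction space of the affine span of [A]. *)
Definition dspan (A : {set T}) : 'M[R]_d :=
  (\sum_(p in finset.setX A A) <<x p.1 - x p.2>>)%MS.

Lemma sub_dspan (A : {set T}) s t : s \in A -> t \in A -> (x s - x t <= dspan A)%MS.
Proof.
move=> sA tA; rewrite (sumsmx_sup (s, t)) ?genmxE //.
by rewrite finset.in_setX sA.
Qed.

Lemma dspan_orth (A : {set T}) (u : 'rV[R]_d) :
  (forall s t, s \in A -> t \in A -> dot (x s - x t) u = 0) ->
  forall v, (v <= dspan A)%MS -> dot v u = 0.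
Proof.
move=> h v vA.
have : (dspan A <= kermx u^T)%MS.
  apply/sumsmx_subP => -[s t]; rewrite finset.in_setX => /andP [/= sA tA].
  rewrite genmxE; apply/sub_kermxP/rowP => i; rewrite ord1 [RHS]mxE.
  exact: h.
by move=> /(submx_trans vA)/sub_kermxP h'; rewrite /dot h' mxE.
Qed.

Definition equidistant (A : {set T}) (p : 'rV[R]_d) : Prop :=
  exists a, forall s, s \in A -> sqdist (x s) p = a.

Lemma equidistant_orth (A : {set T}) p q : equidistant A p -> equidistant A q ->
  forall v, (v <= dspan A)%MS -> dot v (p - q) = 0.
Proof.
move=> [a ha] [c hc]; apply: dspan_orth => s t sA tA.
have := ha s sA; have := ha t tA; have := hc s sA; have := hc t tA.
by rewrite !sqdistE !dot_linE; lra.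
Qed.

Lemma dspan_cross_orth (A B : {set T}) c :
  (forall s t, s \in A -> t \in B -> D s t = c) ->
  forall v w, (v <= dspan A)%MS -> (w <= dspan B)%MS -> dot v w = 0.
Proof.
move=> h v w vA wB; rewrite dotC; move: w wB; apply: dspan_orth => s t sB tB.
rewrite dotC; move: v vA; apply: equidistant_orth.
  by exists c => r rA; exact: h.
by exists c => r rA; exact: h.
Qed.

Lemma dspan_rank_lt (A : {set T}) (u : 'rV[R]_d) : u != 0 ->
  (forall v, (v <= dspan A)%MS -> dot v u = 0) -> (\rank (dspan A) < d)%N.
Proof.
move=> u0 h; have /orth_rank_add : forall v w, (v <= dspan A)%MS -> (w <= u)%MS ->
    dot v w = 0.
  by move=> v w /h vu /sub_rVP [a ->]; rewrite dotZr vu mulr0.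
by rewrite rank_rV u0 addn1 => <-; exact: rank_leq_col.
Qed.

Hypothesis local : locally_two_coloured D.

Lemma local_colours : exists a b : T -> R,
  [/\ forall s, a s != 0, forall s, b s != 0
    & forall s t, s != t -> D s t = a s \/ D s t = b s].
Proof.
suff /choice [f hf] : forall s, exists ab : R * R, [/\ ab.1 != 0, ab.2 != 0
    & forall t, s != t -> D s t = ab.1 \/ D s t = ab.2].
  by exists (fun s => (f s).1), (fun s => (f s).2); split=> s; have [] := hf s.
move=> s; have [[t1 n1]|none] := pselect (exists t, s != t); last first.
  exists (1, 1); rewrite /= oner_eq0; split => // t st.
  by exfalso; apply: none; exists t.
have [[t2 n2 e]|same] := pselect (exists2 t, s != t & D s t != D s t1).
  exists (D s t1, D s t2); rewrite /= !gt_eqF ?D_gt0 //; split => // t n3.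
  have := @local s t t1 t2; rewrite ![_ == s]eq_sym => /(_ n3 n1 n2).
  case; [by left|by right|by move=> h; move: e; rewrite h eqxx].
exists (D s t1, D s t1); rewrite /= !gt_eqF ?D_gt0 //; split => // t n3.
by left; apply/eqP/negPn/negP => h; apply: same; exists t.
Qed.

(** A group of at least two points equidistant from some point lies on a sphere. *)
Lemma group_bound (A : {set T}) (p : 'rV[R]_d) :
  (1 < #|A|)%N -> equidistant A p ->
  (2 * #|A| <= \rank (dspan A) * (\rank (dspan A) + 3))%N.
Proof.
move=> /card_gt1P [s0 [s1 [s0A s1A s01]]] [rho hrho].
have [a [b [a0 b0 hab]]] := local_colours.
pose S := {s : T | s \in A}.
pose z (s : S) := x (val s) - p.
have := @local_sphere_bound R _ _ (dspan A) S z rho (a \o val) (b \o val)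
  (exist _ s0 s0A) (exist _ s1 s1A).
rewrite card_sig /z /= => h.
have : (#|A|.+1 <= 'C((\rank (dspan A)).+2, 2))%N.
  apply: h => //=.
  - by rewrite -subr_eq0 opprB addrA subrK subr_eq0 (inj_eq x_inj).
  - move=> s t; rewrite opprB addrA subrK; apply: sub_dspan; exact: valP.
  - by move=> s; rewrite -(hrho _ (valP s)).
  - by move=> s t st; rewrite sqdistBr; apply: hab; rewrite (inj_eq val_inj).
have := double_bin2 (\rank (dspan A)).+1.
by nia.
Qed.

(** [relative_bound] with the origin moved to [p], which is the circumcentre of [A]
    within its affine span. *)
Lemma relative_group_bound (A : {set T}) (p : 'rV[R]_d) (rho a b : R) :
  0 < rho -> 0 < a -> 0 < b -> a + b <= 4 * rho ->
  (forall s, s \in A -> (x s - p <= dspan A)%MS) ->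
  (forall s, s \in A -> sqdist (x s) p = rho) ->
  (forall s t, s \in A -> t \in A -> s != t -> D s t = a \/ D s t = b) ->
  (2 * #|A| <= \rank (dspan A) * (\rank (dspan A) + 1))%N.
Proof.
move=> rho0 a0 b0 hab pA hrho hD.
pose S := {s : T | s \in A}.
pose z (s : S) := x (val s) - p.
have := @relative_bound R _ _ (dspan A) S z rho a b rho0 a0 b0 hab.
rewrite card_sig /z /= => h.
have : (#|A| + (\rank (dspan A)).+1 <= 'C((\rank (dspan A)).+2, 2))%N.
  apply: h.
  - by move=> s; apply: pA; exact: valP.
  - by move=> s; rewrite -(hrho _ (valP s)).
  - move=> s t st; rewrite sqdistBr; apply: hD; rewrite ?(inj_eq val_inj) //; exact: valP.
have := double_bin2 (\rank (dspan A)).+1.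
by nia.
Qed.

Hypothesis d1 : (1 < d)%N.
Hypothesis large : (d * d.+1 + 2 <= 2 * #|T|)%N.

Lemma equidistant_point (A : {set T}) c t :
  (forall s, s \in A -> D s t = c) -> equidistant A (x t).
Proof. by exists c. Qed.

(** If three groups had [k1], [k2], [k3] dimensions, the total would fall short of
    the bound for [k1 + k2 + k3] dimensions by [k1 k2 + k1 k3 + k2 k3]; this is
    more than the loss of [d - 1] that the number of points leaves room for. *)
Lemma three_groups_false (A1 A2 A3 : {set T}) c12 c13 c23 :
  (forall t, [\/ t \in A1, t \in A2 | t \in A3]) ->
  (1 < #|A1|)%N -> (1 < #|A2|)%N -> (1 < #|A3|)%N ->
  (forall s t, s \in A1 -> t \in A2 -> D s t = c12) ->
  (forall s t, s \in A1 -> t \in A3 -> D s t = c13) ->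
  (forall s t, s \in A2 -> t \in A3 -> D s t = c23) -> False.
Proof.
move=> cover n1 n2 n3 h12 h13 h23.
have [s1 s1A] := elimT card_gt0P (ltnW n1); have [s2 s2A] := elimT card_gt0P (ltnW n2).
have b1 : (2 * #|A1| <= \rank (dspan A1) * (\rank (dspan A1) + 3))%N.
  by apply: (group_bound n1 (p := x s2)); exists c12 => s sA; exact: h12.
have b2 : (2 * #|A2| <= \rank (dspan A2) * (\rank (dspan A2) + 3))%N.
  apply: (group_bound n2 (p := x s1)); exists c12 => s sA.
  by rewrite sqdistC; exact: h12.
have b3 : (2 * #|A3| <= \rank (dspan A3) * (\rank (dspan A3) + 3))%N.
  apply: (group_bound n3 (p := x s1)); exists c13 => s sA.
  by rewrite sqdistC; exact: h13.
have r12 := orth_rank_add (dspan_cross_orth h12).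
have r3 : \rank (dspan A1 + dspan A2 + dspan A3)%MS =
    (\rank (dspan A1 + dspan A2)%MS + \rank (dspan A3))%N.
  apply: orth_rank_add => v w /sub_addsmxP [u ->] wA.
  rewrite dotDl (dspan_cross_orth h13) ?submxMl // (dspan_cross_orth h23) ?submxMl //.
  by rewrite addr0.
have rd : (\rank (dspan A1) + \rank (dspan A2) + \rank (dspan A3) <= d)%N.
  by rewrite -r12 -r3; exact: rank_leq_col.
have cT : (#|T| <= #|A1| + #|A2| + #|A3|)%N.
  rewrite -cardsT; apply: (leq_trans (n := #|A1 :|: A2 :|: A3|)).
    apply/subset_leq_card/fintype.subsetP => t _; rewrite !finset.in_setU.
    by case: (cover t) => ->; rewrite ?orbT.
  apply: leq_trans (leq_card_setU _ _) _.
  by rewrite leq_add2r; exact: leq_card_setU.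
move: b1 b2 b3 rd cT large n1 n2 n3 d1.
move: (\rank _) (\rank _) (\rank _) #|A1| #|A2| #|A3| #|T| => k1 k2 k3 m1 m2 m3 m.
move=> b1 b2 b3 rd cT lg n1 n2 n3 dd.
have e1 : (0 < k1)%N by nia.
have e2 : (0 < k2)%N by nia.
have e3 : (0 < k3)%N by nia.
nia.
Qed.

(** A star yields [c = a] and a triangle yields [c = b]. *)
Definition two_pole_structure : Prop :=
  exists (A : {set T}) p q a b c,
    [/\ p != q, p \notin A, q \notin A & forall t, [\/ t \in A, t = p | t = q]] /\
    [/\ (2 * #|A| = d.-1 * (d + 2))%N,
        forall s, s \in A -> D s p = a, forall s, s \in A -> D s q = c,
        c = a \/ c = b
      & forall s t, s \in A -> t \in A -> s != t -> D s t = a \/ D s t = b].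

(** Two groups lose [k1 k2], which is at least [d - 1] when [k1 + k2 = d], with
    equality only if one of the dimensions is 1: that group consists of the poles. *)
Lemma star_structure (A : {set T}) a g b :
  (1 < #|A|)%N -> (1 < #|~: A|)%N ->
  (forall s t, s \in A -> t \in ~: A -> D s t = a) ->
  (forall s t, s \in A -> t \in A -> s != t -> D s t = a \/ D s t = g) ->
  (forall s t, s \in ~: A -> t \in ~: A -> s != t -> D s t = a \/ D s t = b) ->
  two_pole_structure.
Proof.
move=> nA nB hAB.
wlog rB : A g b nA nB hAB / \rank (dspan (~: A)) = 1%N.
  move=> wl hA hB.
  have [s1 s1A] := elimT card_gt0P (ltnW nA); have [s2 s2A] := elimT card_gt0P (ltnW nB).
  have b1 : (2 * #|A| <= \rank (dspan A) * (\rank (dspan A) + 3))%N.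
    by apply: (group_bound nA (p := x s2)); exists a => s sA; exact: hAB.
  have b2 : (2 * #|~: A| <= \rank (dspan (~: A)) * (\rank (dspan (~: A)) + 3))%N.
    apply: (group_bound nB (p := x s1)); exists a => s sA.
    by rewrite sqdistC; exact: hAB.
  have rd : (\rank (dspan A) + \rank (dspan (~: A)) <= d)%N.
    by rewrite -(orth_rank_add (dspan_cross_orth hAB)); exact: rank_leq_col.
  have cT := cardsC A.
  have [r1|r1] := eqVneq (\rank (dspan (~: A))) 1%N; first exact: (wl A g b).
  apply: (wl (~: A) b g); rewrite ?finset.setCK //.
    by move=> s t sB tA; rewrite DC; exact: hAB.
  move: b1 b2 rd cT large nA nB d1 r1.
  move: (\rank _) (\rank _) #|A| #|~: A| #|T| => k1 k2 m1 m2 m.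
  move=> b1 b2 rd cT lg n1 n2 dd /eqP r1.
  have e1 : (0 < k1)%N by nia.
  have e2 : (0 < k2)%N by nia.
  nia.
move=> hA hB.
have [s1 s1A] := elimT card_gt0P (ltnW nA); have [s2 s2A] := elimT card_gt0P (ltnW nB).
have b1 : (2 * #|A| <= \rank (dspan A) * (\rank (dspan A) + 3))%N.
  by apply: (group_bound nA (p := x s2)); exists a => s sA; exact: hAB.
have b2 : (2 * #|~: A| <= \rank (dspan (~: A)) * (\rank (dspan (~: A)) + 3))%N.
  apply: (group_bound nB (p := x s1)); exists a => s sA.
  by rewrite sqdistC; exact: hAB.
have rd : (\rank (dspan A) + \rank (dspan (~: A)) <= d)%N.
  by rewrite -(orth_rank_add (dspan_cross_orth hAB)); exact: rank_leq_col.
have cT := cardsC A.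
have cB : #|~: A| = 2%N by move: b2; rewrite rB; lia.
have /eqP/cards2P [p [q [pq BE]]] := cB.
have pB : p \in ~: A by rewrite BE !inE eqxx.
have qB : q \in ~: A by rewrite BE !inE eqxx orbT.
exists A, p, q, a, g, a; split; split => //.
- by move: pB; rewrite inE.
- by move: qB; rewrite inE.
- move=> t; have [tA|tA] := boolP (t \in A); first by constructor 1.
  have : t \in ~: A by rewrite inE.
  rewrite BE !inE => /orP [/eqP|/eqP] ->; [by constructor 2|by constructor 3].
- move: b1 rd cT large d1; rewrite cB rB.
  move: (\rank _) #|A| #|T| => k1 m1 m b1 rd cT lg dd.
  have : (k1 = d.-1)%N by nia.
  by nia.
- by move=> s sA; exact: hAB.
- by move=> s sA; exact: hAB.
- by left.
Qed.

Lemma singleton_eq (A : {set T}) s t : (#|A| <= 1)%N -> s \in A -> t \in A -> s = t.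
Proof. by move/card_le1_eqP => h sA tA; exact: h. Qed.

Lemma triangle_card a b c : triangle D a b c ->
  (#|T| <= #|seers D a b| + #|seers D b c| + #|seers D a c|)%N.
Proof.
move=> tri; rewrite -cardsT.
apply: (leq_trans (n := #|seers D a b :|: seers D b c :|: seers D a c|)).
  apply/subset_leq_card/fintype.subsetP => t _; rewrite !finset.in_setU.
  by case: (triangle_cover DC local t tri) => ->; rewrite ?orbT.
apply: leq_trans (leq_card_setU _ _) _.
by rewrite leq_add2r; exact: leq_card_setU.
Qed.

Lemma triangle_cross a b c : triangle D a b c ->
  [/\ forall s t, s \in seers D a b -> t \in seers D b c -> D s t = b,
      forall s t, s \in seers D b c -> t \in seers D a c -> D s t = c
    & forall s t, s \in seers D a b -> t \in seers D a c -> D s t = a].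
Proof.
move=> [[ab bc ac] _].
have ca : c != a by rewrite eq_sym.
have cb : c != b by rewrite eq_sym.
have ba : b != a by rewrite eq_sym.
split=> s t.
- exact: seers_cross.
- by rewrite [seers D a c]seersC; apply: seers_cross; rewrite // eq_sym.
- by rewrite [seers D a b]seersC; apply: seers_cross.
Qed.

(** The two one-point groups are the poles; the third group lies in a hyperplane
    orthogonal to the line joining them. *)
Lemma triangle_two_singletons a b c : triangle D a b c ->
  (#|seers D a b| <= 1)%N -> (#|seers D b c| <= 1)%N -> two_pole_structure.
Proof.
move=> tri n1 n2; have [h12 h23 h13] := triangle_cross tri.
have cT := triangle_card tri.
have [[ab bc ac] [[p p1] [q q2] _]] := tri.
have ca : c != a by rewrite eq_sym.
have cb : c != b by rewrite eq_sym.
have ba : b != a by rewrite eq_sym.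
have n3 : (1 < #|seers D a c|)%N.
  move: n1 n2 cT large d1; move: #|_| #|_| #|_| #|_| => m1 m2 m3 m; nia.
have pq : p != q.
  by apply/eqP => pq; subst q; exact: (seers_disjoint local bc ac ab p1 q2).
have eqp s : s \in seers D a c -> D s p = a by rewrite DC; exact: h13.
have eqq s : s \in seers D a c -> D s q = c by rewrite DC; exact: h23.
have rk : (\rank (dspan (seers D a c)) < d)%N.
  apply: (@dspan_rank_lt _ (x p - x q)).
    by rewrite subr_eq0 (inj_eq x_inj).
  by apply: equidistant_orth; [exists a|exists c].
have bd := group_bound n3 (equidistant_point eqp).
exists (seers D a c), p, q, a, c, c; split; split => //.
- apply/negP => p3; move: p1; rewrite seersC => p1.
  exact: (seers_disjoint local ac bc ba p1 p3).
- apply/negP => p3; move: p3; rewrite seersC => p3.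
  by move: q2 => q2; apply: (seers_disjoint local ca ba bc q2 p3).
- move=> t; have [t1|t2|t3] := triangle_cover DC local t tri.
  + by constructor 2; exact: singleton_eq n1 t1 p1.
  + by constructor 3; exact: singleton_eq n2 t2 q2.
  + by constructor 1.
- move: n1 n2 cT large d1 rk bd; move: #|_| #|_| #|_| #|_| (\rank _) => m1 m2 m3 m k.
  move=> n1 n2 cT lg dd rk bd.
  have dE : d = d.-1.+1 by rewrite prednK // ltnW.
  by move: lg rk; rewrite {1 2 3 4}dE; nia.
- by right.
- by move=> s t s3 t3 st; apply: (seers_D local ac s3); rewrite eq_sym.
Qed.

(** Let [p] be the point of the singleton.  The count allows the other two groups
    to have complementary direction spaces; then [p] is the centre of both,
    Pythagoras gives [c = a + b], and [relative_bound] applies to the group with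
    the larger radius. *)
Lemma triangle_one_singleton_false a b c : triangle D a b c ->
  (#|seers D a b| <= 1)%N -> (1 < #|seers D b c|)%N -> (1 < #|seers D a c|)%N ->
  False.
Proof.
wlog le_ab : a b / a <= b.
  move=> wl tri n1 n2 n3; have [ab|/ltW ba] := leP a b; first exact: (wl a b).
  apply: (wl b a) => //; last by rewrite seersC.
  have [[hab hbc hac] [t1 t2 t3]] := tri.
  by split; split => //; rewrite 1?eq_sym // seersC.
move=> tri n1 n2 n3; have [h12 h23 h13] := triangle_cross tri.
have cT := triangle_card tri.
have [[ab bc ac] [[p p1] _ _]] := tri.
have eq2 s : s \in seers D b c -> D s p = b by rewrite DC; exact: h12.
have eq3 s : s \in seers D a c -> D s p = a by rewrite DC; exact: h13.
have b2 := group_bound n2 (equidistant_point eq2).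
have b3 := group_bound n3 (equidistant_point eq3).
have orth := dspan_cross_orth h23.
have rkE := orth_rank_add orth.
have rd : (\rank (dspan (seers D b c)) + \rank (dspan (seers D a c)) <= d)%N.
  by rewrite -rkE; exact: rank_leq_col.
move: rd; rewrite leq_eqVlt => /orP [/eqP rd|rd]; last first.
  move: n1 n2 n3 cT large d1 b2 b3 rd.
  move: #|_| #|_| #|_| #|_| (\rank _) (\rank _) => m1 m2 m3 m k2 k3.
  move=> n1 n2 n3 cT lg dd b2 b3 rd.
  have e1 : (0 < k2)%N by nia.
  have e2 : (0 < k3)%N by nia.
  by nia.
(* the two affine spans are complementary, so [p] is their common point *)
have full (v : 'rV[R]_d) : (v <= dspan (seers D b c) + dspan (seers D a c))%MS.
  by rewrite submx_full // /row_full rkE rd.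
have in2 s : s \in seers D b c -> (x s - x p <= dspan (seers D b c))%MS.
  move=> s2; have /sub_addsmxP [u uE] := full (x s - x p).
  set v2 := u.1 *m _ in uE; set v3 := u.2 *m _ in uE.
  suff v30 : v3 = 0 by rewrite uE v30 addr0 submxMl.
  apply/eqP; rewrite -dot_eq0.
  have -> : v3 = (x s - x p) - v2 by rewrite uE addrC addKr.
  have v3V : (x s - x p - v2 <= dspan (seers D a c))%MS.
    by rewrite uE addrC addKr submxMl.
  have o : dot v2 (x s - x p - v2) = 0 by apply: orth => //; rewrite submxMl.
  rewrite dotDr dotNr [dot _ v2]dotC o oppr0 addr0.
  apply/eqP; apply: (equidistant_orth (A := seers D a c)) => //.
    by exists c => t t3; rewrite sqdistC; exact: h23.
  by exists a.
have in3 s : s \in seers D a c -> (x s - x p <= dspan (seers D a c))%MS.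
  move=> s3; have /sub_addsmxP [u uE] := full (x s - x p).
  set v2 := u.1 *m _ in uE; set v3 := u.2 *m _ in uE.
  suff v20 : v2 = 0 by rewrite uE v20 add0r submxMl.
  apply/eqP; rewrite -dot_eq0.
  have -> : v2 = (x s - x p) - v3 by rewrite uE addrK.
  have v2V : (x s - x p - v3 <= dspan (seers D b c))%MS.
    by rewrite uE addrK submxMl.
  have o : dot (x s - x p - v3) v3 = 0 by apply: orth => //; rewrite submxMl.
  rewrite dotDr dotNr o oppr0 addr0.
  apply/eqP; apply: (equidistant_orth (A := seers D b c)) => //.
    by exists c => t t2; exact: h23.
  by exists b.
have [s2 s2A] := elimT card_gt0P (ltnW n2); have [s3 s3A] := elimT card_gt0P (ltnW n3).
have cE : c = a + b.
  have := orth _ _ (in2 _ s2A) (in3 _ s3A); rewrite -(h23 s2 s3) // -(eq3 s3 s3A).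
  by rewrite -(eq2 s2 s2A) /D !sqdistE !dot_linE (dotC (x p)); lra.
have a0 : 0 < a.
  rewrite -(eq3 s3 s3A) D_gt0 //; apply/eqP => e; subst s3.
  move: p1; rewrite seersC => p1.
  by apply: (seers_disjoint local ac bc _ p1 s3A); rewrite eq_sym.
have b0 : 0 < b by exact: lt_le_trans le_ab.
have c0 : 0 < c by rewrite cE addr_gt0.
have rb : (2 * #|seers D b c| <= \rank (dspan (seers D b c)) *
    (\rank (dspan (seers D b c)) + 1))%N.
  apply: (relative_group_bound b0 b0 c0 _ in2 eq2); first by rewrite cE; lra.
  by move=> s t sA tA st; apply: (seers_D local bc sA); rewrite eq_sym.
move: n1 n2 n3 cT large d1 rb b3 rd; clear.
move: #|_| #|_| #|_| #|_| (\rank _) (\rank _) => m1 m2 m3 m k2 k3.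
move=> n1 n2 n3 cT lg dd b2 b3 rd.
have e1 : (1 < k2)%N by nia.
have e2 : (0 < k3)%N by nia.
by nia.
Qed.

Lemma triangle_structure a b c : triangle D a b c -> two_pole_structure.
Proof.
move=> tri; have tri2 := triangle_rot tri; have tri3 := triangle_rot tri2.
have [n1|n1] := leqP #|seers D a b| 1; have [n2|n2] := leqP #|seers D b c| 1.
- exact: triangle_two_singletons tri _ _.
- have [n3|n3] := leqP #|seers D a c| 1.
    by apply: (triangle_two_singletons tri3) => //; rewrite seersC.
  by exfalso; exact: triangle_one_singleton_false tri _ _ _.
- have [n3|n3] := leqP #|seers D a c| 1.
    by apply: (triangle_two_singletons tri2) => //; rewrite seersC.
  by exfalso; apply: (triangle_one_singleton_false tri2); rewrite // seersC.
- have [n3|n3] := leqP #|seers D a c| 1.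
    by exfalso; apply: (triangle_one_singleton_false tri3); rewrite // seersC.
  have [h12 h23 h13] := triangle_cross tri.
  exfalso; apply: (three_groups_false _ n1 n2 n3 h12 h13 h23) => t.
  exact: triangle_cover.
Qed.

Lemma many_points_two_poles : three_coloured D -> two_pole_structure.
Proof.
move=> /(star_or_triangle DC local) [[a [b [c]]]|[|]].
- exact: triangle_structure.
- move=> [A [a [g [b [nA nB hAB hA hB]]]]]; exact: star_structure nA nB hAB hA hB.
- move=> [A [B [a [[disj nA nB nC] [hAB hAC hBC]]]]].
  exfalso; apply: (three_groups_false _ nA nB nC hAB hAC hBC) => t.
  have [tA|tA] := boolP (t \in A); first by constructor 1.
  have [tB|tB] := boolP (t \in B); first by constructor 2.
  by constructor 3; rewrite !inE negb_or tA.
Qed.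

End DistanceSets.

(** * Integrals of monomials over the sphere *)

Section TrigIntegrals.
Variable R : realType.
Local Notation mu := (@lebesgue_measure R).

Lemma is_derive_continuous (f F : R -> R) :
  (forall t : R, is_derive t 1 F (f t)) -> continuous F.
Proof.
move=> dF t; have [dFt _] := dF t.
exact/differentiable_continuous/derivable1_diffP.
Qed.

Lemma integral_is_derive (f F : R -> R) (a b : R) : a < b ->
  (forall t : R, is_derive t 1 F (f t)) -> continuous f ->
  \int[mu]_(t in `[a, b]) f t = F b - F a.
Proof.
move=> ab dF cf; have cF := is_derive_continuous dF.
rewrite /Rintegral (@continuous_FTC2 _ f F) //.
- exact: continuous_subspaceT.
- split.
  + by move=> t _; have [] := dF t.
  + by apply: cvg_at_right_filter; exact: cF.
  + by apply: cvg_at_left_filter; exact: cF.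
- by move=> t _; rewrite derive1E; have [_] := dF t.
Qed.

Lemma is_derive_trig (a b : nat) (t : R) :
  is_derive t 1 (fun t : R => sin t ^+ a.+1 * cos t ^+ b.+1)
    (a.+1%:R * (sin t ^+ a * cos t ^+ b.+2) - b.+1%:R * (sin t ^+ a.+2 * cos t ^+ b)).
Proof.
rewrite (_ : (fun t : R => _) = (sin : R -> R) ^+ a.+1 * (cos : R -> R) ^+ b.+1); last first.
  by apply/funext => u; rewrite mulrfctE !exprfctE.
apply: is_derive_eq; rewrite !exprfctE /GRing.scale /= !exprS; ring.
Qed.

Lemma is_derive_sin_pow (a : nat) (t : R) :
  is_derive t 1 (fun t : R => sin t ^+ a.+1) (a.+1%:R * (sin t ^+ a * cos t ^+ 1)).
Proof.
rewrite (_ : (fun t : R => _) = (sin : R -> R) ^+ a.+1); last first.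
  by apply/funext => u; rewrite exprfctE.
by apply: is_derive_eq; rewrite /GRing.scale /=; ring.
Qed.

Definition trig (a b : nat) (t : R) : R := sin t ^+ a * cos t ^+ b.

Lemma continuous_trig a b : continuous (trig a b).
Proof.
move=> t; apply/differentiable_continuous/derivable1_diffP.
rewrite (_ : trig a b = (sin : R -> R) ^+ a * (cos : R -> R) ^+ b); last first.
  by apply/funext => u; rewrite mulrfctE !exprfctE.
exact: ex_derive.
Qed.

Definition trig_int (a b : nat) : R := \int[mu]_(t in `[0, pi]) trig a b t.

Lemma integrable_continuous (f : R -> R) : continuous f ->
  mu.-integrable `[0, pi] (EFin \o f).
Proof.
move=> cf; apply: continuous_compact_integrable; first exact: segment_compact.
exact: continuous_subspaceT.
Qed.

Lemma RintegralD_cont (f g : R -> R) : continuous f -> continuous g ->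
  \int[mu]_(t in `[0, pi]) (f t + g t) =
  \int[mu]_(t in `[0, pi]) f t + \int[mu]_(t in `[0, pi]) g t.
Proof. by move=> cf cg; rewrite RintegralD //; exact: integrable_continuous. Qed.

Lemma RintegralZ_cont (f : R -> R) c : continuous f ->
  \int[mu]_(t in `[0, pi]) (c * f t) = c * \int[mu]_(t in `[0, pi]) f t.
Proof. by move=> cf; rewrite RintegralZl //; exact: integrable_continuous. Qed.

Lemma continuous_scale (f : R -> R) c : continuous f -> continuous (fun t => c * f t).
Proof. by move=> cf t; apply: continuousM; [exact: cst_continuous|exact: cf]. Qed.

Lemma continuous_add (f g : R -> R) : continuous f -> continuous g ->
  continuous (fun t => f t + g t).
Proof. by move=> cf cg t; exact: (continuousD (cf t) (cg t)). Qed.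

(** Integration by parts, through the antiderivative [sin^(a+1) cos^(b+1)]. *)
Lemma trig_int_rec a b :
  (a + b + 2)%:R * trig_int a b.+2 = b.+1%:R * trig_int a b.
Proof.
have parts : a.+1%:R * trig_int a b.+2 + - b.+1%:R * trig_int a.+2 b = 0.
  rewrite /trig_int -!RintegralZ_cont; try exact: continuous_trig.
  rewrite -RintegralD_cont; try exact/continuous_scale/continuous_trig.
  under eq_Rintegral do rewrite mulNr.
  rewrite (integral_is_derive (pi_gt0 R) (is_derive_trig a b)).
  - by rewrite sin0 sinpi !exprS !mul0r subrr.
  - under eq_fun do rewrite -mulNr.
    apply: continuous_add; apply: continuous_scale; exact: continuous_trig.
have split_sq : trig_int a.+2 b = trig_int a b + - 1 * trig_int a b.+2.
  rewrite /trig_int -RintegralZ_cont; last exact: continuous_trig.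
  rewrite -RintegralD_cont; try exact/continuous_scale/continuous_trig; last first.
    exact: continuous_trig.
  apply: eq_Rintegral => t _; rewrite /trig -addn2 exprD sin2cos2.
  by rewrite -[b.+2]addn2 exprD; ring.
move: parts; rewrite split_sq -natr1 -addnA !natrD -[b.+1%:R]natr1; lra.
Qed.

Lemma trig_int1 a : trig_int a 1 = 0.
Proof.
have : a.+1%:R * trig_int a 1 = 0.
  rewrite /trig_int -RintegralZ_cont; last exact: continuous_trig.
  rewrite (integral_is_derive (pi_gt0 R) (is_derive_sin_pow a)).
  - by rewrite sin0 sinpi !exprS !mul0r subrr.
  - exact/continuous_scale/continuous_trig.
by move/eqP; rewrite mulf_eq0 pnatr_eq0 => /eqP.
Qed.

Lemma trig_int_sin a : (a + 2)%:R * trig_int a.+2 0 = a.+1%:R * trig_int a 0.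
Proof.
have split_sq : trig_int a.+2 0 = trig_int a 0 + - 1 * trig_int a 2.
  rewrite /trig_int -RintegralZ_cont; last exact: continuous_trig.
  rewrite -RintegralD_cont; try exact/continuous_scale/continuous_trig; last first.
    exact: continuous_trig.
  apply: eq_Rintegral => t _; rewrite /trig -addn2 exprD sin2cos2.
  by rewrite expr0; ring.
have := trig_int_rec a 0; rewrite split_sq addn0 -[a.+1%:R]natr1 natrD mul1r; lra.
Qed.

Lemma trig_int_gt0 a : 0 < trig_int a 0.
Proof.
suff : 0 < trig_int a 0 /\ 0 < trig_int a.+1 0 by case.
elim: a => [|a [h1 h2]]; split => //.
- rewrite /trig_int /trig; under eq_Rintegral do rewrite !expr0 mul1r.
  rewrite (integral_is_derive (pi_gt0 R) (fun t => is_derive_id t 1)) ?subr0 ?pi_gt0 //.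
  exact: cst_continuous.
- rewrite /trig_int /trig; under eq_Rintegral do rewrite expr1 expr0 mulr1.
  have dcos (t : R) : is_derive t 1 (- (cos : R -> R)) (sin t).
    by apply: is_derive_eq; rewrite opprK.
  rewrite (integral_is_derive (pi_gt0 R) dcos); last exact: continuous_sin.
  by rewrite !opprfctE /= cos0 cospi; lra.
- have := trig_int_sin a; have p2 : 0 < (a + 2)%:R :> R by rewrite ltr0n addn2.
  move=> h; rewrite -(pmulr_rgt0 _ p2) h mulr_gt0 //.
Qed.

End TrigIntegrals.

Section SphereMoments.
Variable R : realType.
Local Notation mu := (@lebesgue_measure R).

Lemma continuous_sum_trig (S : Type) (r : seq S) (c : S -> R) (a b : S -> nat) :
  continuous (fun t => \sum_(s <- r) c s * trig (a s) (b s) t).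
Proof.
elim: r => [|s r IHr].
  by under eq_fun do rewrite big_nil; exact: cst_continuous.
under eq_fun do rewrite big_cons.
apply: continuous_add => //; apply: continuous_scale; exact: continuous_trig.
Qed.

Lemma Rintegral_sum_trig (S : Type) (r : seq S) (c : S -> R) (a b : S -> nat) :
  \int[mu]_(t in `[0, pi]) (\sum_(s <- r) c s * trig (a s) (b s) t) =
  \sum_(s <- r) c s * trig_int R (a s) (b s).
Proof.
elim: r => [|s r IHr].
  under eq_Rintegral do rewrite big_nil.
  by rewrite big_nil Rintegral_cst //= mul0r.
under eq_Rintegral do rewrite big_cons.
rewrite RintegralD_cont; last exact: continuous_sum_trig.
  by rewrite big_cons IHr RintegralZ_cont //; exact: continuous_trig.
by apply: continuous_scale; exact: continuous_trig.
Qed.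

Definition mono (n : nat) (e : 'I_n -> nat) (x : 'rV[R]_n) : R :=
  \prod_i x 0 i ^+ e i.

Definition degree (n : nat) (e : 'I_n -> nat) : nat := (\sum_i e i)%N.

Definition tail (n : nat) (e : 'I_n.+1 -> nat) (i : 'I_n) : nat := e (lift ord0 i).

(** The integral of the monomial with exponents [e], computed in polar coordinates. *)
Fixpoint sphere_moment (n : nat) : ('I_n.+1 -> nat) -> R :=
  match n with
  | 0 => fun e => 1 + (- 1) ^+ e ord0
  | m.+1 => fun e =>
      trig_int R (m + degree (tail e)) (e ord0) * sphere_moment (tail e)
  end.

Lemma sphere_momentSS (n : nat) (e : 'I_n.+2 -> nat) :
  sphere_moment e =
  trig_int R (n + degree (tail e)) (e ord0) * sphere_moment (tail e).
Proof. by []. Qed.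

Lemma mono_polar (n : nat) (e : 'I_n.+1 -> nat) (a b : R) (y : 'rV[R]_n) :
  mono e (row_mx a%:M (b *: y) : 'rV[R]_(1 + n)) =
  a ^+ e ord0 * b ^+ degree (tail e) * mono (tail e) y.
Proof.
have h0 : (row_mx a%:M (b *: y) : 'rV[R]_(1 + n)) 0 (lshift n ord0) = a.
  by rewrite row_mxEl mxE eqxx.
have h1 i : (row_mx a%:M (b *: y) : 'rV[R]_(1 + n)) 0 (rshift 1 i) = b * y 0 i.
  by rewrite row_mxEr mxE.
have e0 : ord0 = lshift n (ord0 : 'I_1) by apply: val_inj.
have e1 i : lift ord0 i = rshift 1 i by apply: val_inj.
rewrite /mono big_ord_recl -mulrA; congr (_ * _).
  by rewrite -{2}h0 -e0.
rewrite /degree -prodrXr -big_split /=; apply: eq_bigr => i _.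
by rewrite -exprMn -h1 -e1.
Qed.

Lemma sphere_integral_sum (n : nat) (S : Type) (r : seq S) (c : S -> R)
    (e : S -> 'I_n.+1 -> nat) :
  sphere_integral (fun x => \sum_(s <- r) c s * mono (e s) x) =
  \sum_(s <- r) c s * sphere_moment (e s).
Proof.
elim: n => [|n IHn] in c e *.
  rewrite /= -big_split /=; apply: eq_bigr => s _.
  by rewrite /mono !big_ord1 !mxE expr1n -mulrDr.
rewrite [LHS]/(sphere_integral _) -/(@sphere_integral R n.+1).
under eq_Rintegral => t _.
  under [X in sphere_integral X]eq_fun => y.
    under eq_bigr => s _ do rewrite mono_polar mulrA.
    over.
  rewrite IHn mulr_sumr.
  under eq_bigr => s _.
    have -> : sin t ^+ n * (c s * (cos t ^+ e s ord0 * sin t ^+ degree (tail (e s))) *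
       sphere_moment (tail (e s))) =
       c s * sphere_moment (tail (e s)) * trig (n + degree (tail (e s))) (e s ord0) t.
      by rewrite /trig exprD; ring.
    over.
  over.
rewrite Rintegral_sum_trig; apply: eq_bigr => s _ /=; ring.
Qed.

(** [gauss k] is the [k]-th moment of a standard Gaussian variable. *)
Fixpoint gauss (k : nat) : nat :=
  match k with 0 => 1 | k'.+1 => match k' with 0 => 0 | k''.+1 => k' * gauss k'' end end.

Lemma gaussSS k : gauss k.+2 = (k.+1 * gauss k)%N.
Proof. by []. Qed.

Definition gauss_moment (n : nat) (e : 'I_n -> nat) : nat := (\prod_i gauss (e i))%N.

(** [rise n m] is [n (n + 2) ... (n + m - 2)] for even [m]: the factor by which
    the moments of degree [m] of a Gaussian vector exceed those of the sphere. *)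
Fixpoint rise (n m : nat) : nat :=
  match m with 0 => 1 | m'.+1 => match m' with 0 => 1 | m''.+1 => rise n m'' * (n + m'') end end.

Lemma riseSS n m : rise n m.+2 = (rise n m * (n + m))%N.
Proof. by []. Qed.

Lemma nat_ind2 (P : nat -> Prop) :
  P 0%N -> P 1%N -> (forall n, P n -> P n.+2) -> forall n, P n.
Proof.
move=> h0 h1 hS n; suff [] : P n /\ P n.+1 by [].
by elim: n => [//|n [hn hn1]]; split=> //; exact: hS.
Qed.

Lemma rise_gt0 n m : (0 < n)%N -> (0 < rise n m)%N.
Proof.
move=> n0; elim/nat_ind2: m => [||m IH] //.
by rewrite riseSS muln_gt0 IH addn_gt0 n0.
Qed.

Lemma riseD n m b : ~~ odd b -> rise n (m + b) = (rise n m * rise (n + m) b)%N.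
Proof.
elim/nat_ind2: b => [||b IH] // ob; first by rewrite addn0 muln1.
have /IH h : ~~ odd b by move: ob; rewrite /= negbK.
by rewrite !addnS !riseSS h mulnA -addnA.
Qed.

Lemma gauss_odd k : odd k -> gauss k = 0%N.
Proof.
elim/nat_ind2: k => [||k IH] //; rewrite gaussSS /= negbK => /IH ->.
by rewrite muln0.
Qed.

Lemma gauss_moment_odd n (e : 'I_n -> nat) : odd (degree e) -> gauss_moment e = 0%N.
Proof.
move=> oe; have [i oi] : exists i, odd (e i).
  apply/existsP; apply: contraLR oe; rewrite negb_exists => /forallP h.
  by rewrite /degree; elim/big_ind: _ => // x y; rewrite oddD => /negPf -> /negPf ->.
by rewrite /gauss_moment (bigD1 i) //= gauss_odd.
Qed.

Lemma degree_tail n (e : 'I_n.+1 -> nat) : degree e = (e ord0 + degree (tail e))%N.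
Proof. by rewrite /degree big_ord_recl. Qed.

Lemma gauss_moment_tail n (e : 'I_n.+1 -> nat) :
  gauss_moment e = (gauss (e ord0) * gauss_moment (tail e))%N.
Proof. by rewrite /gauss_moment big_ord_recl. Qed.

Lemma trig_int_gauss a b :
  trig_int R a b * (rise (a + 2) b)%:R = (gauss b)%:R * trig_int R a 0.
Proof.
elim/nat_ind2: b => [||b IH]; first by rewrite mulr1 mul1r.
  by rewrite trig_int1 !mul0r.
have e : (a + 2 + b = a + b + 2)%N by lia.
rewrite riseSS gaussSS e !natrM; have h := trig_int_rec R a b.
transitivity ((rise (a + 2) b)%:R * ((a + b + 2)%:R * trig_int R a b.+2)).
  by ring.
by rewrite h mulrCA [_ * trig_int R a b]mulrC IH; ring.
Qed.

Lemma trig_int_rise a m : ~~ odd m ->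
  trig_int R (a + m) 0 * (rise (a + 2) m)%:R = trig_int R a 0 * (rise (a + 1) m)%:R.
Proof.
elim/nat_ind2: m => [||m IH] // om; first by rewrite addn0 !mulr1.
have /IH h : ~~ odd m by move: om; rewrite /= negbK.
have e : (a + 2 + m = a + m + 2)%N by lia.
have e1 : (a + 1 + m = (a + m).+1)%N by lia.
have e2 : (a + m.+2 = (a + m).+2)%N by lia.
rewrite !riseSS e e1 e2 !natrM; have h1 := trig_int_sin R (a + m).
transitivity ((rise (a + 2) m)%:R * ((a + m + 2)%:R * trig_int R (a + m).+2 0)).
  by ring.
by rewrite h1 mulrCA [_ * trig_int R (a + m) 0]mulrC h; ring.
Qed.

(** The factors [rise] coming from the integrals in each polar angle telescope. *)
Lemma sphere_moment_gauss n (e : 'I_n.+1 -> nat) :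
  sphere_moment e * (rise n.+1 (degree e))%:R =
  sphere_moment (fun _ : 'I_n.+1 => 0%N) * (gauss_moment e)%:R.
Proof.
elim: n => [|n IHn] in e *.
  rewrite /gauss_moment /degree !big_ord1.
  rewrite [sphere_moment e]/= [sphere_moment _]/= expr0.
  elim/nat_ind2: (e ord0) => [||b IH].
  - by rewrite expr0.
  - by rewrite expr1 subrr mulr0 mul0r.
  - rewrite riseSS gaussSS add1n !natrM mulrA.
    have -> : (-1) ^+ b.+2 = (-1) ^+ b :> R by rewrite !exprS; ring.
    by rewrite IH; ring.
rewrite !sphere_momentSS gauss_moment_tail.
have d0 : degree (tail (fun _ : 'I_n.+2 => 0%N)) = 0%N by rewrite /degree big1.
rewrite d0 addn0.
set m := degree (tail e); set b := e ord0.
have [om|em] := boolP (odd m).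
  have := IHn (tail e); rewrite gauss_moment_odd // mulr0 => /eqP.
  rewrite mulf_eq0 pnatr_eq0 -leqn0 leqNgt rise_gt0 // orbF => /eqP ->.
  by rewrite muln0 !mulr0 mul0r.
have [ob|eb] := boolP (odd b).
  have := trig_int_gauss (n + m) b; rewrite gauss_odd // mul0r => /eqP.
  rewrite mulf_eq0 pnatr_eq0 -leqn0 leqNgt rise_gt0 ?addn2 // orbF => /eqP ->.
  by rewrite mul0n !mul0r mulr0.
have := IHn (tail e); rewrite -/m => h1.
have h2 := trig_int_gauss (n + m) b; have h3 := trig_int_rise n em.
rewrite degree_tail -/m -/b [(b + m)%N]addnC riseD // !natrM.
have e1 : (n.+2 + m = n + m + 2)%N by lia.
move: h1 h3; rewrite e1 addn1 addn2 => h1 h3.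
transitivity ((rise n.+2 m)%:R * sphere_moment (tail e) *
  (trig_int R (n + m) b * (rise (n + m + 2) b)%:R)); first by ring.
rewrite h2.
transitivity ((gauss b)%:R * sphere_moment (tail e) *
  (trig_int R (n + m) 0 * (rise n.+2 m)%:R)); first by ring.
rewrite h3.
transitivity ((gauss b)%:R * trig_int R n 0 *
  (sphere_moment (tail e) * (rise n.+1 m)%:R)); first by ring.
by rewrite h1; ring.
Qed.

Lemma sphere_moment_gt0 n : 0 < sphere_moment (fun _ : 'I_n.+1 => 0%N).
Proof.
elim: n => [|n IHn]; first by rewrite /= expr0; lra.
by rewrite sphere_momentSS mulr_gt0 // trig_int_gt0.
Qed.

Lemma sphere_average n (S : Type) (r : seq S) (c : S -> R) (e : S -> 'I_n.+1 -> nat) :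
  (sphere_integral (fun _ : 'rV[R]_n.+1 => 1))^-1 *
    sphere_integral (fun x => \sum_(s <- r) c s * mono (e s) x) =
  \sum_(s <- r) c s * ((gauss_moment (e s))%:R / (rise n.+1 (degree (e s)))%:R).
Proof.
have -> : (fun _ : 'rV[R]_n.+1 => 1) =
    (fun x => \sum_(s <- [:: tt]) 1 * mono (fun=> 0%N) x).
  by apply/funext => x; rewrite big_seq1 mul1r /mono big1.
rewrite !sphere_integral_sum big_seq1 mul1r mulr_sumr; apply: eq_bigr => s _.
have r0 : (rise n.+1 (degree (e s)))%:R != 0 :> R.
  by rewrite pnatr_eq0 -lt0n rise_gt0.
have m0 := lt0r_neq0 (sphere_moment_gt0 n).
rewrite mulrCA; congr (_ * _); apply: (mulIf r0); apply: (mulfI m0).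
by rewrite divfK // -sphere_moment_gauss -!mulrA mulVKf.
Qed.

End SphereMoments.

(** * Equiangular lines and tight spherical five-designs *)

Definition incr (n : nat) (i : 'I_n) (e : 'I_n -> nat) (j : 'I_n) : nat :=
  ((i == j) + e j)%N.

Lemma degree_incr n (i : 'I_n) e : degree (incr i e) = (degree e).+1.
Proof.
rewrite /degree /incr big_split /= (bigD1 i) //= eqxx big1 // => j ji.
by rewrite eq_sym (negPf ji).
Qed.

Lemma degree_incr_ex n (e : 'I_n -> nat) k : degree e = k.+1 ->
  exists i e', e = incr i e' /\ degree e' = k.
Proof.
move=> he; have [i ei] : exists i, (0 < e i)%N.
  apply/existsP; apply: contra_eqT he; rewrite negb_exists => /forallP h.
  by rewrite /degree big1 // => i _; apply/eqP; rewrite -leqn0 leqNgt h.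
pose e' j := (e j - (i == j))%N.
have eE : e = incr i e'.
  apply/funext => j; rewrite /incr /e'.
  by case: (eqVneq i j) => [<-|_]; rewrite ?subnKC ?add0n ?subn0.
by exists i, e'; split => //; apply: succn_inj; rewrite -he eE degree_incr.
Qed.

Lemma degree0_eq n (e : 'I_n -> nat) : degree e = 0%N -> e = fun=> 0%N.
Proof.
move=> /eqP; rewrite /degree sum_nat_eq0 => /forallP h.
by apply/funext => i; apply/eqP; exact: h.
Qed.

Lemma mono_incr (R : realType) n (i : 'I_n) e (x : 'rV[R]_n) :
  mono (incr i e) x = x 0 i * mono e x.
Proof.
rewrite /mono /incr (bigD1 i) //= [in RHS](bigD1 i) //= eqxx exprS mulrA.
congr (_ * _); apply: eq_bigr => j ji.
by rewrite eq_sym (negPf ji).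
Qed.

Lemma mono0 (R : realType) n (x : 'rV[R]_n) : mono (fun=> 0%N) x = 1.
Proof. by rewrite /mono big1. Qed.

Lemma mono_scale (R : realType) n (e : 'I_n -> nat) a (x : 'rV[R]_n) :
  mono e (a *: x) = a ^+ degree e * mono e x.
Proof.
rewrite /mono /degree -prodrXr -big_split /=.
by apply: eq_bigr => i _; rewrite mxE exprMn.
Qed.

(** Stein's identity for Gaussian moments. *)
Lemma gauss_moment_incr n (i : 'I_n) e :
  gauss_moment (incr i e) = (e i * gauss_moment (fun j => e j - (i == j)))%N.
Proof.
rewrite /gauss_moment /incr (bigD1 i) //= [in RHS](bigD1 i) //= eqxx mulnA.
congr (_ * _)%N; first by case: (e i) => [//|k]; rewrite add1n subn1.
by apply: eq_bigr => j ji; rewrite eq_sym (negPf ji) subn0.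
Qed.

Lemma gauss_moment2 n (i j : 'I_n) :
  gauss_moment (incr i (incr j (fun=> 0%N))) = (i == j).
Proof.
rewrite gauss_moment_incr {1}/incr addn0; have [->|//] := eqVneq i j.
by rewrite mul1n /gauss_moment big1 // => k _; rewrite /incr addn0 subnn.
Qed.

(** Wick's formula in degree four. *)
Lemma gauss_moment4 n (i j k l : 'I_n) :
  gauss_moment (incr i (incr j (incr k (incr l (fun=> 0%N))))) =
  ((i == k) * (j == l) + (i == l) * (j == k) + (i == j) * (k == l))%N.
Proof.
rewrite gauss_moment_incr {1}/incr {1}/incr {1}/incr addn0.
have [e|ij] := eqVneq i j.
  subst j.
  rewrite (_ : (fun _ => _) = incr k (incr l (fun=> 0%N))); last first.
    by apply/funext => m; rewrite /incr addKn.
  rewrite gauss_moment2; have [e|kl] := eqVneq k l.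
    subst l; by rewrite [k == i]eq_sym; case: (i == k).
  rewrite muln0; have [ik|ik] := eqVneq i k; last by rewrite !muln0.
  by subst k; rewrite (negPf kl).
rewrite add0n; have [e|ik] := eqVneq i k.
  subst k.
  rewrite (_ : (fun _ => _) = incr j (incr l (fun=> 0%N))); last first.
    by apply/funext => m; rewrite /incr addnCA addKn.
  rewrite gauss_moment2; have [e|jl] := eqVneq j l; last first.
    by rewrite [j == i]eq_sym (negPf ij) !muln0.
  subst l; by rewrite eq_sym (negPf ij).
rewrite add0n; have [e|il] := eqVneq i l; last by [].
subst l.
rewrite (_ : (fun _ => _) = incr j (incr k (fun=> 0%N))); last first.
  by apply/funext => m; rewrite /incr !addn0 addnA addnK.
by rewrite gauss_moment2 /= !mul0n addn0 add0n.
Qed.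

Section EquiangularDesign.
Variables (R : realType) (n : nat) (S : finType) (e : S -> 'rV[R]_n.+1).
Let k : R := (n.+1%:R + 2)^-1.
Hypothesis cS : #|S| = 'C(n.+2, 2).
Hypothesis e1 : forall s, dot (e s) (e s) = 1.
Hypothesis ek : forall s t, s != t -> dot (e s) (e t) ^+ 2 = k.

Let k1 : k != 1.
Proof.
rewrite /k invr_eq1 gt_eqF //; have : 0 <= n%:R :> R by [].
by rewrite -natr1; lra.
Qed.

Lemma equiangular_mono_sum (m : 'I_n.+1 -> nat) : (degree m <= 5)%N ->
  ~~ odd (degree m) ->
  \sum_s mono m (e s) = #|S|%:R * ((gauss_moment m)%:R / (rise n.+1 (degree m))%:R).
Proof.
have cSR : #|S|%:R = n.+1%:R * (n.+1%:R + 1) / 2 :> R.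
  by rewrite cS -bin2_natr; field.
have n10 : n.+1%:R != 0 :> R by rewrite pnatr_eq0.
have n20 : n.+1%:R + 2 != 0 :> R by rewrite gt_eqF // ltr_wpDl.
have dd i j : dot (delta_mx 0 i) (delta_mx 0 j) = (i == j)%:R :> R.
  by rewrite dot_delta mxE eqxx /= eq_sym.
case dm : (degree m) => [|[|[|[|[|[|q]]]]]] // _ _.
- rewrite (degree0_eq dm); under eq_bigr do rewrite mono0.
  by rewrite sumr_const /gauss_moment big1 // divr1 mulr1.
- have [i [m1 [-> d1]]] := degree_incr_ex dm.
  have [j [m0 [-> /degree0_eq ->]]] := degree_incr_ex d1.
  under eq_bigr do rewrite !mono_incr mono0 mulr1 -!dot_delta.
  rewrite (equiangular_moment2 k1 cS e1 ek erefl) dd gauss_moment2 /= mul1n addn0 cSR.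
  by field.
- have [i [m3 [-> d3]]] := degree_incr_ex dm.
  have [j [m2 [-> d2]]] := degree_incr_ex d3.
  have [k' [m1 [-> d1]]] := degree_incr_ex d2.
  have [l [m0 [-> /degree0_eq ->]]] := degree_incr_ex d1.
  under eq_bigr do rewrite !mono_incr mono0 mulr1 mulrA -!dot_delta.
  rewrite (equiangular_moment4 k1 cS e1 ek erefl) !dd gauss_moment4.
  rewrite /= mul1n addn0 natrM cSR !natrD !natrM.
by field; rewrite (addrC 1) natr1 n10 n20.
Qed.

Let f (p : bool * S) : 'rV[R]_n.+1 := (-1) ^+ p.1 *: e p.2.

Let f_inj : injective f.
Proof.
have sgn (a b : bool) : (-1) ^+ a * (-1) ^+ b = (-1) ^+ (a (+) b) :> R.
  by rewrite signr_addb.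
move=> [a s] [b t] h.
have : dot (f (a, s)) (f (b, t)) = 1 by rewrite h /f dotZl dotZr e1 mulr1 -expr2 sqrr_sign.
rewrite /f /= dotZl dotZr mulrA sgn.
have [<-{t h}|st] := eqVneq s t.
  rewrite e1 mulr1; case: (boolP (a (+) b)) => ab; last first.
    by move: ab; case: a; case: b.
  by rewrite expr1 => h; exfalso; lra.
move=> h2; have := ek st.
have : ((-1) ^+ (a (+) b) * dot (e s) (e t)) ^+ 2 = 1 by rewrite h2 expr1n.
by rewrite exprMn sqrr_sign mul1r => -> h3; move: k1; rewrite h3 eqxx.
Qed.

(** The design consists of the two unit vectors on each of the lines; opposite
    vectors cancel in odd degree and double the moments in even degree. *)
Lemma equiangular_design : exists Z : {fset 'rV[R]_n.+1},
  tight_spherical_five_design Z /\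
  forall s, e s \in Z /\ - e s \in Z.
Proof.
pose Z := [fset f p | p in {: bool * S}]%fset.
have cZ : #|` Z| = (2 * #|S|)%N.
  rewrite card_imfset; last exact: f_inj.
  by rewrite -cardE card_prod card_bool.
exists Z; split; last first.
  move=> s; split; apply/imfsetP => /=.
    by exists (false, s) => //; rewrite /f expr0 scale1r.
  by exists (true, s) => //; rewrite /f expr1 scaleN1r.
split; last by rewrite cZ cS.
split.
  move=> z /= /imfsetP [[b s] _ ->]; apply/sphereE.
  by rewrite /f dotZl dotZr e1 mulr1 -expr2 sqrr_sign.
move=> p hp.
have pE : poly_fun p =
    (fun x => \sum_(m <- msupp p) mcoeff m p * mono (fun i => m i) x).
  by apply/funext => x; rewrite /poly_fun mevalE.
rewrite pE sphere_average exchange_big /= mulr_sumr.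
apply: eq_big_seq => m mp; rewrite -mulr_sumr [RHS]mulrCA; congr (_ * _).
have dm : (degree (fun i => m i) <= 5)%N.
  by have := msize_mdeg_lt mp; rewrite mdegE -/(degree _) => /leq_trans/(_ hp).
rewrite cZ /Z big_imfset /=; last by move=> ? ? _ _; exact: f_inj.
rewrite big_enum /= -(pair_big xpredT xpredT (fun b s => mono (fun i => m i) (f (b, s)))) /=.
rewrite big_bool /= /f /=.
under eq_bigr do rewrite mono_scale.
under [X in _ * (_ + X)]eq_bigr do rewrite mono_scale.
rewrite -!mulr_sumr expr0 !expr1 expr1n mul1r.
have [om|em] := boolP (odd (degree (fun i => m i))).
  by rewrite gauss_moment_odd // -signr_odd om expr1 mulN1r addNr mulr0 mul0r.
rewrite -signr_odd (negPf em) expr0 mul1r equiangular_mono_sum // natrM.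
have S0 : #|S|%:R != 0 :> R by rewrite cS pnatr_eq0 -lt0n bin_gt0.
have r0 : (rise n.+1 (degree (fun i => m i)))%:R != 0 :> R.
  by rewrite pnatr_eq0 -lt0n rise_gt0.
by field; rewrite S0 r0.
Qed.

End EquiangularDesign.

(** * From sets of points to finite families *)

Lemma edist_inj (R : realType) n (u v u' v' : 'rV[R]_n) :
  Defs.edist u v = Defs.edist u' v' -> sqdist u v = sqdist u' v'.
Proof.
by rewrite !edistE => /eqP; rewrite eqr_sqrt ?dot_ge0 // => /eqP.
Qed.

Lemma card_ge_fset (R : realType) d (X : set 'rV[R]_d) n : `I_n #<= X ->
  exists F : {fset 'rV[R]_d}, [set` F] `<=` X /\ #|` F| = n.
Proof.
move=> /pcard_leP [f]; pose F := [fset f (val i) | i in 'I_n]%fset.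
exists F; split.
  move=> z /= /imfsetP [i _ ->]; apply: (@funS _ _ _ _ f); exact: ltn_ord.
rewrite card_in_imfset ?size_enum_ord //= => i j _ _ h.
apply/val_inj/(inj (f := f)) => //; rewrite inE; exact: ltn_ord.
Qed.

Lemma card_le2 (T : choiceType) (A : set T) a b c : A #<= `I_2 ->
  A a -> A b -> A c -> [\/ a = b, a = c | b = c].
Proof.
move=> A2 Aa Ab Ac.
have [->|ab] := eqVneq a b; first by constructor 1.
have [->|ac] := eqVneq a c; first by constructor 2.
have [->|bc] := eqVneq b c; first by constructor 3.
suff : `I_3 #<= `I_2 by rewrite card_le_II.
have c3 : [set` [fset a; b; c]%fset] #= `I_3.
  by apply/card_eq_fsetP; rewrite fsetUC cardfsU1 cardfs2 !inE ab negb_or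
    ![c == _]eq_sym ac bc.
rewrite -(card_le_eql c3); apply: card_le_trans A2; apply: subset_card_le.
by move=> z /=; rewrite !inE => /orP [/orP [/eqP ->|/eqP ->]|/eqP ->].
Qed.

Lemma half_pronic n : ((n * n.+1)./2 * 2 = n * n.+1)%N.
Proof. by rewrite muln2 halfK oddM /= andbN subn0. Qed.

Section FiniteSubsets.
Variables (R : realType) (d : nat) (X : set 'rV[R]_d).

Let D (F : {fset 'rV[R]_d}) (s t : F) : R := sqdist (val s) (val t).
Arguments D : clear implicits.

Lemma local_fset (F : {fset 'rV[R]_d}) : locally_two_distance X -> [set` F] `<=` X ->
  locally_two_coloured (D F).
Proof.
move=> lX FX s t1 t2 t3 n1 n2 n3.
have mem t : t != s -> distances_from X (val s) (Defs.edist (val s) (val t)).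
  move=> ts; exists (val t); split => //; first by apply: FX => /=; exact: valP.
  by rewrite (inj_eq val_inj) eq_sym.
have := card_le2 (lX _ (FX _ (valP s))) (mem _ n1) (mem _ n2) (mem _ n3).
by case=> /edist_inj h; [constructor 1|constructor 2|constructor 3].
Qed.

Definition three_distances : Prop :=
  exists r1 r2 r3, [/\ r1 != r2, r2 != r3 & r1 != r3] /\
    [/\ distances X r1, distances X r2 & distances X r3].

Lemma three_distances_fset : three_distances ->
  exists F0 : {fset 'rV[R]_d}, [set` F0] `<=` X /\
    forall F : {fset 'rV[R]_d}, [set` F0] `<=` [set` F] -> three_coloured (D F).
Proof.
move=> [r1 [r2 [r3 [[n12 n23 n13] [
  [x1 [y1 [X1 Y1 xy1 e1]]] [x2 [y2 [X2 Y2 xy2 e2]]] [x3 [y3 [X3 Y3 xy3 e3]]]]]]]].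
exists [fset x1; y1; x2; y2; x3; y3]%fset; split.
  by move=> z /=; rewrite !inE => /orP [/orP [/orP [/orP [/orP [] | ] | ] | ] | ] /eqP ->.
move=> F sub.
have seen x y : x != y -> x \in F -> y \in F -> exists s, sees (D F) s (sqdist x y).
  move=> xy xF yF; exists [` xF]%fset; apply/seesP; exists [` yF]%fset => //.
  by rewrite -val_eqE /= eq_sym.
have neq x y x' y' : Defs.edist x y != Defs.edist x' y' -> sqdist x y != sqdist x' y'.
  by rewrite !edistE; apply: contra => /eqP ->.
exists (sqdist x1 y1), (sqdist x2 y2), (sqdist x3 y3); split.
  by split; apply: neq; rewrite -?e1 -?e2 -?e3.
by split; apply: seen => //; apply: sub; rewrite /= !inE eqxx ?orbT.
Qed.

Lemma one_distance_fset (F : {fset 'rV[R]_d}) : [set` F] `<=` X ->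
  (forall r1 r2, distances X r1 -> distances X r2 -> r1 = r2) ->
  (#|` F| <= d.+1)%N.
Proof.
move=> FX one; rewrite cardfE.
have dF (s t : F) : s != t -> distances X (Defs.edist (val s) (val t)).
  move=> st; exists (val s), (val t); split => //; try by apply: FX => /=; exact: valP.
have [[s0 [t0 st0]]|none] := pselect (exists s t : F, s != t).
  apply: (@one_distance_bound _ _ _ (fun s : F => val s) (sqdist (val s0) (val t0))).
    by rewrite gt_eqF // sqdist_gt0 (inj_eq val_inj).
  by move=> s t st; apply/edist_inj/one; exact: dF.
apply: (@leq_trans 1) => //; apply/card_le1_eqP => s t _ _; apply/eqP/negPn/negP => st.
by apply: none; exists t, s.
Qed.

(** A set with at most one distance is too small, and one with two distances
    is not proper. *)
Lemma proper_three_distances : (1 < d)%N -> proper_locally_two_distance X ->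
  `I_((d * d.+1)./2).+1 #<= X -> three_distances.
Proof.
move=> d1 [_ not2] /card_ge_fset [F [FX cF]].
have [//|no3] := pselect three_distances; exfalso.
have [[r1 [r2 [n12 D1 D2]]]|one] := pselect (exists r1 r2,
    [/\ r1 != r2, distances X r1 & distances X r2]); last first.
  have : (#|` F| <= d.+1)%N.
    apply: one_distance_fset => // r1 r2 D1 D2; apply/eqP/negPn/negP => n12.
    by apply: one; exists r1, r2.
  by rewrite cF; have := half_pronic d; nia.
apply: not2; rewrite /two_distance.
have -> : distances X = [set` [fset r1; r2]%fset].
  apply/seteqP; split=> r /=; rewrite !inE; last by move=> /orP [/eqP ->|/eqP ->].
  move=> Dr; apply/negPn/negP; rewrite negb_or => /andP [rr1 rr2].
  by apply: no3; exists r1, r2, r; split; split => //; rewrite eq_sym.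
by apply/card_eq_fsetP; rewrite cardfs2 n12.
Qed.

Lemma large_fset : three_distances -> `I_((d * d.+1)./2).+1 #<= X ->
  exists F0 : {fset 'rV[R]_d}, [set` F0] `<=` X /\
    forall F : {fset 'rV[R]_d}, [set` F0] `<=` [set` F] ->
      three_coloured (D F) /\ (d * d.+1 + 2 <= 2 * #|{: F}|)%N.
Proof.
move=> /three_distances_fset [F1 [F1X h1]] /card_ge_fset [F2 [F2X c2]].
exists (F1 `|` F2)%fset; split.
  by move=> z /=; rewrite inE => /orP [/F1X|/F2X].
move=> F sub; split.
  by apply: h1 => z zF; apply: sub; rewrite /= inE; apply/orP; left.
have : (#|` F2| <= #|` F|)%N.
  apply: fsubset_leq_card; apply/fsubsetP => z zF.
  by apply: (sub z); rewrite /= inE zF orbT.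
rewrite c2 -cardfE => h.
by have := half_pronic d; lia.
Qed.

End FiniteSubsets.

(** * The two consequences of the two-pole structure *)

Lemma sqdistZ (R : realType) n a (u v : 'rV[R]_n) :
  sqdist (a *: u) (a *: v) = a ^+ 2 * sqdist u v.
Proof. by rewrite /sqdist -scalerBr dotZl dotZr; ring. Qed.

Lemma poles_isometry (R : realType) (n : nat) (S : Type) (x : S -> 'rV[R]_n.+1)
    (p q : 'rV[R]_n.+1) (a c : R) (s0 s1 : S) :
  p != q -> x s0 != x s1 ->
  (forall s, sqdist (x s) p = a) -> (forall s, sqdist (x s) q = c) ->
  exists (y : S -> 'rV[R]_n) (r : R),
    [/\ 0 < r, forall s, dot (y s) (y s) = 1
      & forall s t, sqdist (y s) (y t) = r * sqdist (x s) (x t)].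
Proof.
move=> pq s01 ha hc; set N := dot (p - q) (p - q).
have N0 : 0 < N by rewrite dot_gt0 subr_eq0.
have sN0 : Num.sqrt N != 0 by rewrite gt_eqF // sqrtr_gt0.
have sN2 : Num.sqrt N ^+ 2 = N by rewrite sqr_sqrtr // ltW.
pose e := (Num.sqrt N)^-1 *: (p - q).
have e1 : dot e e = 1 by rewrite dotZl dotZr -/N -[X in _ * (_ * X)]sN2; field.
pose tau := (Num.sqrt N)^-1 * ((c - a - N) / 2).
have ztau s : dot (x s - p) e = tau.
  rewrite dotZr /tau; congr (_ * _); rewrite -(hc s) -(ha s) /N !sqdistE !dot_linE.
  by rewrite (dotC q p); field.
have [y0 hy0] := hyperplane_isometry e1 ztau.
have dy s t : sqdist (y0 s) (y0 t) = sqdist (x s) (x t).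
  by rewrite -[RHS](sqdistBr _ _ p) !sqdistE !hy0; ring.
set rho := a - tau ^+ 2.
have hrho s : dot (y0 s) (y0 s) = rho by rewrite hy0 -/(sqdist _ _) ha.
have rho0 : 0 < rho.
  rewrite -(hrho s0) dot_gt0; apply: contra s01 => /eqP y00.
  have /eqP : rho = 0 by rewrite -(hrho s0) y00 dot0l.
  rewrite -(hrho s1) dot_eq0 => /eqP y10.
  by rewrite -subr_eq0 -dot_eq0 -/(sqdist _ _) -dy y00 y10 /sqdist subrr dot0l.
exists (fun s => (Num.sqrt rho)^-1 *: y0 s), rho^-1; split.
- by rewrite invr_gt0.
- move=> s; rewrite dotZl dotZr hrho mulrA -expr2 exprVn sqr_sqrtr ?ltW //.
  by rewrite mulVf // gt_eqF.
- by move=> s t; rewrite sqdistZ dy exprVn sqr_sqrtr // ltW.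
Qed.

Lemma card_add2 (T : finType) (A : {set T}) p q :
  p != q -> p \notin A -> q \notin A -> (forall t, [\/ t \in A, t = p | t = q]) ->
  #|T| = #|A|.+2.
Proof.
move=> pq pA qA cover; have <- : #|(p |: (q |: A))%SET| = #|A|.+2.
  by rewrite !cardsU1 !inE negb_or pq pA qA.
rewrite -cardsT; apply: eq_card => t; rewrite !inE.
by case: (cover t) => ->; rewrite ?eqxx ?orbT.
Qed.

Lemma two_pole_card (R : realType) (d : nat) (T : finType) (x : T -> 'rV[R]_d) :
  (1 < d)%N -> two_pole_structure x -> (2 * #|T| = d * d.+1 + 2)%N.
Proof.
move=> d1 [A [p [q [a [b [c [[pq pA qA cover] [cA _ _ _ _]]]]]]]].
rewrite (card_add2 pq pA qA cover).
by move: d1 cA; clear; case: d => [//|n] _ /=; nia.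
Qed.

Lemma sphere_two_distance (R : realType) (n : nat) (T : finType)
    (x : T -> 'rV[R]_n.+1) : injective x -> (1 < n)%N -> two_pole_structure x ->
  exists Y : set 'rV[R]_n,
    [/\ Y `<=` sphere R n, two_distance Y & Y #= `I_('C(n.+1, 2) + 'C(n, 1))].
Proof.
move=> x_inj n1 [A [p [q [a [b [c [[pq pA qA cover] [cA ha hc cab hD]]]]]]]].
have nA : (1 < #|A|)%N by move: cA; rewrite /=; nia.
have /card_gt1P [s0 [s1 [s0A s1A s01]]] := nA.
pose S := {s : T | s \in A}; pose z (s : S) := x (val s).
have [] := @poles_isometry _ _ S z (x p) (x q) a c (exist _ s0 s0A) (exist _ s1 s1A).
- by rewrite (inj_eq x_inj).
- by rewrite (inj_eq x_inj).
- by move=> s; apply: ha; exact: valP.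
- by move=> s; apply: hc; exact: valP.
move=> y [r [r0 y1 yD]].
have y_inj : injective y.
  move=> s t yst; apply/val_inj/x_inj/eqP; rewrite -subr_eq0 -dot_eq0.
  have : r * sqdist (x (val s)) (x (val t)) = 0.
    by rewrite -yD yst /sqdist subrr dot0l.
  by move/eqP; rewrite mulf_eq0 (gt_eqF r0).
have cS : #|{: S}| = ('C(n.+1, 2) + 'C(n, 1))%N.
  rewrite card_sig bin1; have -> : #|[pred s | s \in A]| = #|A| by apply: eq_card.
  by have := double_bin2 n; move: cA; rewrite /=; nia.
pose Y := [fset y s | s in {: S}]%fset.
exists [set` Y]; split.
- by move=> v /= /imfsetP [s _ ->]; apply/sphereE.
- have yDab s t : s != t -> sqdist (y s) (y t) = r * a \/ sqdist (y s) (y t) = r * b.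
    move=> st; rewrite yD.
    by case: (hD _ _ (valP s) (valP t) st) => ->; [left|right].
  (* a single distance would allow at most [n + 1] points *)
  have both : forall u, exists s t, s != t /\ sqdist (y s) (y t) != u.
    move=> u; apply/not_existsP => h.
    have hu s t : s != t -> sqdist (y s) (y t) = u.
      move=> st; apply/eqP/negPn/negP => ne; apply: (h s); by exists t.
    have u0 : u != 0.
      rewrite -(hu (exist _ s0 s0A) (exist _ s1 s1A)) // gt_eqF // sqdist_gt0.
      by rewrite (inj_eq y_inj).
    have := one_distance_bound u0 hu; rewrite cS bin1.
    by have := double_bin2 n; nia.
  have [s2 [t2 [st2 e2]]] := both (r * a).
  have [s3 [t3 [st3 e3]]] := both (r * b).
  have e2b : sqdist (y s2) (y t2) = r * b.
    by case: (yDab _ _ st2) => // h; move: e2; rewrite h eqxx.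
  have e3a : sqdist (y s3) (y t3) = r * a.
    by case: (yDab _ _ st3) => // h; move: e3; rewrite h eqxx.
  have YE : distances [set` Y] = [set` [fset Num.sqrt (r * a); Num.sqrt (r * b)]%fset].
    apply/seteqP; split=> v /=.
      move=> [u [w [/imfsetP [s _ ->] /imfsetP [t _ ->] ne ->]]].
      rewrite !inE edistE; have st : s != t by apply: contra ne => /eqP ->.
      by case: (yDab _ _ st) => ->; rewrite eqxx ?orbT.
    have mem s : y s \in Y by apply/imfsetP; exists s.
    rewrite !inE => /orP [/eqP ->|/eqP ->].
      by exists (y s3), (y t3); split; rewrite ?(inj_eq y_inj) ?edistE ?e3a //; exact: mem.
    by exists (y s2), (y t2); split; rewrite ?(inj_eq y_inj) ?edistE ?e2b //; exact: mem.
  rewrite /two_distance YE; apply/card_eq_fsetP; rewrite cardfs2.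
  have -> // : Num.sqrt (r * a) != Num.sqrt (r * b).
  by rewrite -e3a eqr_sqrt ?dot_ge0 //; rewrite -e2b dot_ge0.
- by apply/card_eq_fsetP; rewrite card_imfset //= -cS cardE.
Qed.

Section SphericalCase.
Local Open Scope set_scope.
Variables (R : realType) (n : nat) (T : finType) (x : T -> 'rV[R]_n.+1).
Hypothesis x_inj : injective x.
Hypothesis x1 : forall s, dot (x s) (x s) = 1.
Let D s t := sqdist (x s) (x t).
Hypothesis local : locally_two_coloured D.
Hypothesis three : three_coloured D.
Hypothesis n0 : (0 < n)%N.

Let DE s t : D s t = 2 - 2 * dot (x s) (x t).
Proof. by rewrite /D sqdistE !x1; ring. Qed.

Let DC s t : D s t = D t s. Proof. exact: sqdistC. Qed.

Let D_gt0 s t : s != t -> 0 < D s t.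
Proof. by rewrite /D sqdist_gt0 (inj_eq x_inj). Qed.

Let D_le4 s t : D s t <= 4.
Proof.
have : 0 <= dot (x s + x t) (x s + x t) by exact: dot_ge0.
by rewrite DE !dot_linE !x1 (dotC (x t)); lra.
Qed.

(** The points of [A] are equidistant from [p], from [q] and from the origin, and
    there are so many of them that their differences span a hyperplane; both
    poles lie on the line orthogonal to it. *)
Lemma poles_antipodal (A : {set T}) p q a c : p != q ->
  (2 * #|A| = n * (n + 3))%N ->
  (forall s, s \in A -> D s p = a) -> (forall s, s \in A -> D s q = c) ->
  x q = - x p.
Proof.
move=> pq cA ha hc.
have nA : (1 < #|A|)%N by nia.
have bd := group_bound x_inj local nA (equidistant_point ha).
have rk : (n <= \rank (dspan x A))%N by nia.
have eq0 : equidistant x A 0.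
  by exists 1 => s _; rewrite sqdistE !dot_linE x1; ring.
have orth v w : (v <= dspan x A)%MS -> (w <= x p + x q)%MS -> dot v w = 0.
  move=> vA /sub_addsmxP [[u1 u2] /= ->].
  have hp : dot v (x p) = 0.
    by rewrite -[x p]subr0; exact: equidistant_orth (equidistant_point ha) eq0 _ vA.
  have hq : dot v (x q) = 0.
    by rewrite -[x q]subr0; exact: equidistant_orth (equidistant_point hc) eq0 _ vA.
  rewrite dotDr [u1]mx11_scalar [u2]mx11_scalar !mul_scalar_mx !dotZr hp hq.
  by rewrite !mulr0 addr0.
have xp0 : x p != 0 by rewrite -dot_gt0 x1.
have rW : (\rank (x p + x q)%MS <= \rank (x p))%N.
  have := orth_rank_add orth; have := rank_leq_col (dspan x A + (x p + x q))%MS.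
  by rewrite rank_rV xp0; lia.
have : (x q <= x p)%MS.
  apply: submx_trans (addsmxSr (x p) (x q)) _.
  by rewrite -(geq_leqif (mxrank_leqif_sup (addsmxSl (x p) (x q)))).
move=> /sub_rVP [l ql].
have : l ^+ 2 = 1 by have := x1 q; rewrite ql dotZl dotZr x1 mulr1 -expr2.
move=> /eqP; rewrite sqrf_eq1 => /orP [/eqP l1|/eqP l1].
  by move: pq; rewrite -(inj_eq x_inj) ql l1 scale1r eqxx.
by rewrite ql l1 scaleN1r.
Qed.

(** The points of [A] lie on the equator.  The third distance of the whole set is
    neither that of orthogonal points nor that of the poles, so it occurs in [A]
    and is less than 2; then [A] is too large for [orthogonal_bound]. *)
Lemma equator_false (A : {set T}) p q b :
  p != q -> (forall t, [\/ t \in A, t = p | t = q]) ->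
  (2 * #|A| = n * (n + 3))%N ->
  (forall s, s \in A -> D s p = 2) -> (forall s, s \in A -> D s q = 2) ->
  (forall s t, s \in A -> t \in A -> s != t -> D s t = 2 \/ D s t = b) -> False.
Proof.
move=> pq cover cA hp hq hD.
have qp := poles_antipodal pq cA hp hq.
have Dpq : D p q = 4 by rewrite DE qp dotNr x1; ring.
have [b2 b4 [s0 [t0 [st0 e0]]]] : [/\ b != 2, b != 4 & exists s t, s != t /\ D s t = b].
  have [//|no] := pselect [/\ b != 2, b != 4 & exists s t, s != t /\ D s t = b].
  have D24 s t : t != s -> D s t = 2 \/ D s t = 4.
    move=> ts; have st : s != t by rewrite eq_sym.
    have [e|ne2] := eqVneq (D s t) 2; first by left.
    have [e|ne4] := eqVneq (D s t) 4; first by right.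
    exfalso; apply: no.
    suff e : D s t = b by rewrite -e; split => //; exists s, t.
    move: ne2 ne4 => /eqP ne2 /eqP ne4.
    case: (cover s) => hs; case: (cover t) => ht; subst => //.
    - by case: (hD _ _ hs ht st).
    - by case: ne2; exact: hp.
    - by case: ne2; exact: hq.
    - by case: ne2; rewrite DC; exact: hp.
    - by move: ts; rewrite eqxx.
    - by case: ne2; rewrite DC; exact: hq.
    - by case: ne4; rewrite DC.
    - by move: ts; rewrite eqxx.
  have col c : (exists s, sees D s c) -> c = 2 \/ c = 4.
    by move=> [s /seesP [t ts <-]]; exact: D24.
  have [c1 [c2 [c3 [[n12 n23 n13] [h1 h2 h3]]]]] := three.
  exfalso; move: n12 n23 n13.
  by case: (col _ h1) => ->; case: (col _ h2) => ->; case: (col _ h3) => ->;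
    rewrite eqxx.
have b0 : b != 0 by rewrite -e0 gt_eqF // D_gt0.
have b_lt4 : b < 4 by rewrite lt_neqAle b4 -e0 D_le4.
pose S := {s : T | s \in A}.
have cS : #|{: S}| = #|A| by rewrite card_sig; apply: eq_card.
have zp (s : S) : dot (x (val s)) (x p) = 0.
  by have := hp _ (valP s); rewrite DE; lra.
have [y hy] := hyperplane_isometry (x1 p) zp.
have := @orthogonal_bound R n S y b b0.
have cAR : 2 * #|A|%:R = n%:R * (n%:R + 3) :> R.
  by rewrite -!natrD -!natrM cA.
have nR : 1 <= n%:R :> R by rewrite ler1n.
have -> : #|{: S}|%:R != n%:R * (b / 2).
  rewrite cS gt_eqF //; apply: lt_le_trans (_ : 2 * n%:R <= _).
    by rewrite mulrC ltr_pM2r; lra.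
  by nra.
have yD s t : sqdist (y s) (y t) = D (val s) (val t).
  by rewrite DE sqdistE !hy !x1; ring.
move=> /(_ isT) h; have : (#|{: S}|.+2 <= 'C(n.+2, 2))%N.
  apply: h => [s|s t st]; first by rewrite hy x1; ring.
  by rewrite yD; exact: (hD _ _ (valP s) (valP t) st).
by rewrite cS; have := double_bin2 n.+1; nia.
Qed.

Hypothesis large : (n.+1 * n.+2 + 2 <= 2 * #|T|)%N.

(** Antipodal poles give [a + c = 4].  If [c = b], the inner products [1 - a / 2]
    and [1 - b / 2] are opposite, and the lines through [p] and the points of [A]
    are equiangular; [q = - p] adds no line. *)
Lemma spherical_design_cover : exists Z : {fset 'rV[R]_n.+1},
  tight_spherical_five_design Z /\ forall s, x s \in Z.
Proof.
have [A [p [q [a [b [c [[pq pA qA cover] [cA ha hc cab hD]]]]]]]] :=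
  many_points_two_poles x_inj local (n0 : (1 < n.+1)%N) large three.
have {}cA : (2 * #|A| = n * (n + 3))%N by move: cA; rewrite /= => ->; lia.
have qp := poles_antipodal pq cA ha hc.
have nA : (0 < #|A|)%N by nia.
have [s0 s0A] := elimT card_gt0P nA.
have ac : a + c = 4.
  by rewrite -(ha _ s0A) -(hc _ s0A) -!/(D _ _) !DE qp dotNr; ring.
case: cab => cE.
  exfalso; have a2 : a = 2 by move: ac; rewrite cE; lra.
  apply: (@equator_false A p q b) => //.
  - by move=> s sA; rewrite -a2; exact: ha.
  - by move=> s sA; rewrite -a2 -cE; exact: hc.
  - by move=> s t sA tA st; rewrite -a2; exact: hD.
(* all points but [q] span equiangular lines *)
have bE : b = 4 - a by move: ac; rewrite cE; lra.
have a0 : 0 < a.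
  by rewrite -(ha _ s0A) D_gt0 //; apply: contra pA => /eqP <-.
have b0 : 0 < b.
  by rewrite -cE -(hc _ s0A) D_gt0 //; apply: contra qA => /eqP <-.
pose S := {s : T | s != q}; pose e (s : S) := x (val s).
have Tn := card_add2 pq pA qA cover.
have cS : #|{: S}| = 'C(n.+2, 2).
  have -> : #|{: S}| = #|A|.+1.
    rewrite card_sig -[RHS]/(#|A|.+2.-1) -Tn -(cardC1 q).
    by apply: eq_card => s; rewrite !inE.
  by have := double_bin2 n.+1; nia.
have e1 s : dot (e s) (e s) = 1 by exact: x1.
pose h := 1 - a / 2.
have eD (s t : S) : s != t -> D (val s) (val t) = a \/ D (val s) (val t) = b.
  rewrite -val_eqE /= => st; have := valP s; have := valP t => /= tq sq.
  case: (cover (val s)) => hs; case: (cover (val t)) => ht.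
  - exact: hD.
  - by left; rewrite ht; exact: ha.
  - by move: tq; rewrite ht eqxx.
  - by left; rewrite hs DC; exact: ha.
  - by move: st; rewrite hs ht eqxx.
  - by move: tq; rewrite ht eqxx.
  - by move: sq; rewrite hs eqxx.
  - by move: sq; rewrite hs eqxx.
  - by move: sq; rewrite hs eqxx.
have eh s t : s != t -> dot (e s) (e t) ^+ 2 = h ^+ 2.
  move=> /eD; rewrite DE -/(e s) -/(e t) => hs.
  have [->|->] : dot (e s) (e t) = h \/ dot (e s) (e t) = - h.
  - by rewrite /h; case: hs => hs; [left|right]; lra.
  - by [].
  - by rewrite sqrrN.
have h1 : h ^+ 2 != 1.
  rewrite sqrf_eq1 negb_or; apply/andP; split; apply/eqP; rewrite /h => e_h.
    by move: a0; lra.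
  by move: b0; lra.
have hE := equiangular_angle h1 cS e1 eh (n0 : (1 < n.+1)%N).
rewrite hE in eh.
have [Z [tZ hZ]] := equiangular_design cS e1 eh.
exists Z; split => // s; have [->|sq] := eqVneq s q.
  by rewrite qp; have [] := hZ (exist _ p pq).
by have [] := hZ (exist _ s sq).
Qed.

End SphericalCase.

Lemma design_S0 (R : realType) : exists Z : {fset 'rV[R]_1},
  tight_spherical_five_design Z /\ sphere R 1 `<=` [set` Z].
Proof.
pose e (s : 'I_1) : 'rV[R]_1 := const_mx 1.
have e1 s : dot (e s) (e s) = 1 by rewrite dotE big_ord1 !mxE mulr1.
have c1 : #|'I_1| = 'C(2, 2) by rewrite card_ord.
have ek s t : s != t -> dot (e s) (e t) ^+ 2 = (1%:R + 2)^-1.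
  by rewrite !ord1 eqxx.
have [Z [tZ hZ]] := equiangular_design c1 e1 ek.
exists Z; split => // x /sphereE; rewrite dotE big_ord1 -expr2 => /eqP.
rewrite sqrf_eq1 /= => /orP [/eqP h|/eqP h].
  have -> : x = e ord0 by apply/rowP => i; rewrite ord1 h mxE.
  by have [] := hZ ord0.
have -> : x = - e ord0 by apply/rowP => i; rewrite ord1 h !mxE.
by have [] := hZ ord0.
Qed.

Lemma proper_local_two_distance_sphere (R : realType) (n : nat)
    (X : set 'rV[R]_n.+1) : (1 < n)%N ->
  proper_locally_two_distance X -> `I_((n.+1 * n.+2)./2).+1 #<= X ->
  exists Y : set 'rV[R]_n,
    [/\ Y `<=` sphere R n, two_distance Y & Y #= `I_('C(n.+1, 2) + 'C(n, 1))].
Proof.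
move=> n1 pX cX; have d1 : (1 < n.+1)%N by rewrite ltnS ltnW.
have [F0 [F0X h]] := large_fset (proper_three_distances d1 pX cX) cX.
have [three large] := h F0 (fun _ => id).
apply: (@sphere_two_distance R n {: F0} val val_inj n1).
exact: (many_points_two_poles val_inj (local_fset pX.1 F0X) d1 large three).
Qed.

(** The two-pole structure determines the number of points, so every finite
    subset of [X] containing [F0] is as large as [F0], and [X] is [F0]. *)
Lemma spherical_subset_design (R : realType) (n : nat) (X : set 'rV[R]_n.+1) :
  X `<=` sphere R n.+1 -> proper_locally_two_distance X ->
  `I_((n.+1 * n.+2)./2).+1 #<= X ->
  exists Z : {fset 'rV[R]_n.+1}, tight_spherical_five_design Z /\ X `<=` [set` Z].
Proof.
move=> XS pX cX; have [n0|n0] := posnP n.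
  subst n; have [Z [tZ hZ]] := design_S0 R.
  by exists Z; split => //; apply: subset_trans hZ.
have d1 : (1 < n.+1)%N by [].
have [F0 [F0X h]] := large_fset (proper_three_distances d1 pX cX) cX.
have [three large] := h F0 (fun _ => id).
have [|Z [tZ hZ]] := @spherical_design_cover R n {: F0} val val_inj _
  (local_fset pX.1 F0X) three n0 large.
  by move=> s; apply/sphereE/XS/F0X => /=; exact: valP.
have card (F : {fset 'rV[R]_n.+1}) : [set` F0] `<=` [set` F] -> [set` F] `<=` X ->
    (2 * #|` F| = n.+1 * n.+2 + 2)%N.
  move=> sub FX; have [threeF largeF] := h F sub; rewrite cardfE.
  exact: (two_pole_card d1 (many_points_two_poles val_inj (local_fset pX.1 FX) d1 largeF threeF)).
exists Z; split => // y Xy /=.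
suff yF : y \in F0 by exact: (hZ [` yF]%fset).
apply/negPn/negP => yF.
have c0 := card F0 (fun _ => id) F0X.
have := card (y |` F0)%fset; rewrite cardfsU1 yF /= => c1.
have : (2 * (1 + #|` F0|) = n.+1 * n.+2 + 2)%N.
  apply: c1 => z /=; first by move=> zF; rewrite !inE zF orbT.
  by rewrite !inE => /orP [/eqP ->|/F0X].
by lia.
Qed.

Theorem theorem4p13 (R : realType) (d : nat) (hd : (0 < d)%N) :
  ((2 < d)%N ->
   (exists X : set 'rV[R]_d,
      proper_locally_two_distance X /\ `I_((d * d.+1)./2).+1 #<= X) ->
   exists Y : set 'rV[R]_d.-1,
     [/\ Y `<=` sphere R d.-1, two_distance Y
       & Y #= `I_('C(d, 2) + 'C(d.-1, 1))])
  /\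
  ((2 < d)%N ->
   (exists X : set 'rV[R]_d,
      [/\ X `<=` sphere R d, proper_locally_two_distance X
        & `I_((d * d.+1)./2).+1 #<= X]) ->
   exists Y : set 'rV[R]_d.-1,
     [/\ Y `<=` sphere R d.-1, two_distance Y
       & Y #= `I_('C(d, 2) + 'C(d.-1, 1))])
  /\
  (forall X : set 'rV[R]_d,
     X `<=` sphere R d -> proper_locally_two_distance X ->
     `I_((d * d.+1)./2).+1 #<= X ->
     exists Z : {fset 'rV[R]_d},
       tight_spherical_five_design Z /\ X `<=` [set` Z]).
Proof.
case: d hd => [//|n] _; split; [|split].
- move=> n1 [X [pX cX]]; exact: proper_local_two_distance_sphere pX cX.
- move=> n1 [X [_ pX cX]]; exact: proper_local_two_distance_sphere pX cX.
- move=> X; exact: spherical_subset_design.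
Qed.
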